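(* Let $T_A$ be the rearrangement group of the Airplane limit space and let $E=\{f\in T_A : D_p(f)=1\ \text{for all } p\in\mathcal{E}\}$, where $\mathcal E$ is the set of external extremes of rays and $D_p$ denotes the extremal derivative at $p$. The group $E$ is not finitely generated.
   Context: The Airplane rearrangement group $T_A$. Graphs are finite directed multigraphs with edges coloured red or blue. The base graph $\Gamma$ has vertices $l,a,b,r$, blue edges $e_L:a\to l$ and $e_R:b\to r$, and red edges $e_U:b\to a$ and $e_D:a\to b$. Replacement rules: a red edge from $v_i$ to $v_t$ is replaced by the graph with vertices $v_i,v_t$ and two new vertices $m,w$, with red edges $\mathsf r_1:v_i\to m$, $\mathsf r_2:m\to v_t$ and a blue edge $\mathsf s:m\to w$; a blue edge from $v_i$ to $v_t$ is replaced by the graph with vertices $v_i,v_t$ and two new vertices $x,y$, with blue edges $\mathsf b_-:x\to v_i$, $\mathsf b_+:y\to v_t$ and red edges $\mathsf u:y\to x$, $\mathsf d:x\to y$. An expansion is any graph obtained from $\Gamma$ by finitely many (possibly zero) replacements of single edges. Each edge of an expansion is named by the finite word $e_0e_1\cdots e_k$ recording the edge $e_0$ of $\Gamma$ from which it descends and the successive edges of replacement graphs. Let $\Gamma_0=\Gamma$, and let $\Gamma_{n+1}$ be obtained from $\Gamma_n$ by replacing every edge. Let $\Omega$ be the set of infinite words all of whose finite nonempty prefixes name edges (topologized as a subspace of a product of finite discrete sets). Two such words $e_0e_1\cdots$ and $f_0f_1\cdots$ are equivalent if for every $n$ the edges $e_0\cdots e_n$ and $f_0\cdots f_n$ of $\Gamma_n$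 share at least one vertex; this is an equivalence relation, and the Airplane limit space $A$ is the quotient of $\Omega$ by it, with the quotient topology. Each vertex $v$ of an expansion is identified with the point of $A$ represented by the words all of whose sufficiently long prefixes name edges incident to $v$. The cell $\chi(e)$ of an edge $e$ is the set of points of $A$ represented by words beginning with $e$. A cellular partition is a cover of $A$ by finitely many cells with pairwise disjoint interiors. If $e,e'$ are edges of the same colour, the canonical homeomorphism $\chi(e)\to\chi(e')$ sends the class of $ew$ to the class of $e'w$. A rearrangement is a homeomorphism $f:A\to A$ for which there is a cellular partition such that $f$ restricts on each of its cells to a canonical homeomorphism onto some cell. Rearrangements form a group $T_A$ under composition. Graph pair diagrams. Each $f\in T_A$ is represented by graph pair diagrams: isomorphisms $\varphi:D\to R$ between expansions, preserving colours and the directions of red edges (directions of blue edges are ignored), such that for each edge $e$ of $D$, $f$ maps $\chi(e)$ onto $\chi(\varphi(e))$ canonically, or, if $e$ is blue and $\varphi$ reverses its direction, by the map sending the classes of $e\mathsf b_\pm w$, $e\mathsf u w$, $e\mathsf d w$ to those of $\varphi(e)\mathsf b_\mp w$, $\varphi(e)\mathsf d w$, $\varphi(e)\mathsf u w$. Expanding an edge of $D$ and its image in $R$ gives another diagram for $f$; the reduced diagram of $f$ is the unique one that is not an expansion of another. Extremal derivatives. Call a blue edge radial if it is $e_L$, $e_R$, or its word ends with $\mathsf s$. Rays are in bijection with radial edges: the ray of $e$ is the set of points represented by words $ew$ with $w$ not containing $\mathsf s$, minus its two extreme points, which are the endpoints of $e$. The external extreme of the ray is the terminal vertex of $e$, and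 $\mathcal E\subset A$ is the set of external extremes of all rays; $T_A$ permutes $\mathcal E$. Every blue edge is uniquely of the form $et$ with $e$ radial and $t$ a word of length $k\ge0$ in $\mathsf b_-,\mathsf b_+$; its length is $1/2^k$. Let $p\in\mathcal E$, $f\in T_A$, with reduced graph pair diagram $\varphi:D\to R$. If $p$ is not a vertex of $D$, set $D_p(f)=1$. Otherwise $p$ is an endpoint of a unique edge $e_p$ of $D$, which is blue, and the extremal derivative $D_p(f)$ is the ratio of the length of $\varphi(e_p)$ to the length of $e_p$. *)

(* Defs.v *)
From HB Require Import structures.
From mathcomp Require Import all_boot all_order all_algebra generic_quotient.
From mathcomp Require Import finmap.
From mathcomp Require Import all_classical topology.

Set Implicit Arguments.
Unset Strict Implicit.
Unset Printing Implicit Defensive.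

Import GRing.Theory.

Local Open Scope classical_set_scope.
Local Open Scope quotient_scope.

(* [eL], [eR], [eU], [eD] are the edges of the base graph; [r1], [r2], [sr] the
   edges r_1, r_2, s of the red replacement graph; [bm], [bp], [up], [dn] the
   edges b_-, b_+, u, d of the blue one. *)
Inductive letter := eL | eR | eU | eD | r1 | r2 | sr | bm | bp | up | dn.

Definition letter_code (c : letter) : 'I_11 :=
  match c with
  | eL => @Ordinal 11 0 isT | eR => @Ordinal 11 1 isT
  | eU => @Ordinal 11 2 isT | eD => @Ordinal 11 3 isT
  | r1 => @Ordinal 11 4 isT | r2 => @Ordinal 11 5 isT
  | sr => @Ordinal 11 6 isT | bm => @Ordinal 11 7 isT
  | bp => @Ordinal 11 8 isT | up => @Ordinal 11 9 isT
  | dn => @Ordinal 11 10 isT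
  end.

Definition letter_decode (i : 'I_11) : letter :=
  nth eL [:: eL; eR; eU; eD; r1; r2; sr; bm; bp; up; dn] i.

Lemma letter_codeK : cancel letter_code letter_decode.
Proof. by case. Qed.

HB.instance Definition _ := Finite.copy letter (can_type letter_codeK).

Definition word := seq letter.

Definition base : pred letter := [in [:: eL; eR; eU; eD]].
Definition red : pred letter := [in [:: eU; eD; r1; r2; up; dn]].

Definition is_red (e : word) : bool := red (last eL e).

Definition replacement (c : letter) : word :=
  if red c then [:: r1; r2; sr] else [:: bm; bp; up; dn].

Definition edge (e : word) : bool :=
  if e is c :: e' then base c && path (fun c d => d \in replacement c) c e'
  else false.

(* A vertex is a vertex of the base graph, or one of the two new vertices of
   the graph replacing an edge [e]: [nm], [nw] (the vertices m, w) if [e] is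
   red, [nx], [ny] (the vertices x, y) if [e] is blue. *)
Inductive new_vertex := nm | nw | nx | ny.
Inductive vertex := vl | va | vb | vr | New of word & new_vertex.

(* (initial vertex, terminal vertex), by recursion on the reversed word *)
Fixpoint rev_ends (re : word) : vertex * vertex :=
  if re isn't c :: re' then (vl, vl) else
  let e := rev re' in
  let: (vi, vt) := rev_ends re' in
  match c with
  | eL => (va, vl) | eR => (vb, vr) | eU => (vb, va) | eD => (va, vb)
  | r1 => (vi, New e nm) | r2 => (New e nm, vt) | sr => (New e nm, New e nw)
  | bm => (New e nx, vi) | bp => (New e ny, vt)
  | up => (New e ny, New e nx) | dn => (New e nx, New e ny)
  end.

Definition source (e : word) : vertex := (rev_ends (rev e)).1.
Definition target (e : word) : vertex := (rev_ends (rev e)).2.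

Definition incident (v : vertex) (e : word) : Prop :=
  v = source e \/ v = target e.

Definition adjacent (e f : word) : Prop :=
  exists2 v, incident v e & incident v f.

Definition replace_edge (D : {fset word}) (e : word) : {fset word} :=
  ((D `\ e) `|`
   [fset e' in [seq rcons e c | c <- replacement (last eL e)]])%fset.

(* An expansion is represented by its set of edges; it has no isolated
   vertices. *)
Inductive expansion : {fset word} -> Prop :=
| expansion_base : expansion [fset [:: eL]; [:: eR]; [:: eU]; [:: eD]]%fset
| expansion_replace D e :
    expansion D -> e \in D -> expansion (replace_edge D e).

Definition vertices (D : {fset word}) : set vertex :=
  [set v | exists2 e, e \in D & incident v e].

Definition letter_seq : Type :=
  prod_topology (fun _ : nat => discrete_topology letter).
HB.instance Definition _ := Topological.on letter_seq.

Definition Omega : Type :=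
  [set x : letter_seq | forall n, edge (mkseq x n.+1)].
HB.instance Definition _ := Topological.on Omega.

Definition letters (x : Omega) : nat -> letter := set_val x.

Definition prefix (x : Omega) (n : nat) : word := mkseq (letters x) n.

Definition equivalent (x y : Omega) : Prop :=
  forall n, adjacent (prefix x n.+1) (prefix y n.+1).

Lemma edge_prefix (x : Omega) n : edge (prefix x n.+1).
Proof. by have := set_valP x; apply. Qed.

Lemma prefixS (x : Omega) n : prefix x n.+1 = rcons (prefix x n) (letters x n).
Proof. exact: mkseqS. Qed.

Lemma replacement_nbase c d : d \in replacement c -> ~~ base d.
Proof. by case: c; case: d. Qed.

Lemma letters_nbase (x : Omega) n : ~~ base (letters x n.+1).
Proof.
have := edge_prefix x n.+1; rewrite prefixS prefixS.
case: (prefix x n) => [|c e] /=; first by case/and3P=> _ /replacement_nbase.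
by rewrite rcons_path last_rcons => /and3P[_ _ /replacement_nbase].
Qed.

Lemma size_new e e' k : incident (New e k) e' -> (size e < size e')%N.
Proof.
rewrite /incident /source /target -(size_rev e').
elim: (rev e') => [|c re IH] /=; first by case.
have sz : size (rev re) = size re by rewrite size_rev.
move: IH; case: (rev_ends re) => vi vt /= IH.
by case: c; case=> // h; (try by case: h => -> _; rewrite sz);
  apply/ltnW/IH; auto.
Qed.

Lemma incident_rcons v e c : ~~ base c -> incident v (rcons e c) ->
  incident v e \/ exists k, v = New e k.
Proof.
rewrite /incident /source /target rev_rcons /=.
case: (rev_ends (rev e)) => vi vt; rewrite revK.
by case: c => //= _ [] ->; auto; right; eexists.
Qed.

Lemma rcons_ends e c v w : ~~ base c -> incident v (rcons e c) ->
  incident w (rcons e c) -> incident v e -> incident w e -> v = w.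
Proof.
have new k : ~ incident (New e k) e by move=> /size_new; rewrite ltnn.
move=> cN; rewrite {1 2}/incident /source /target rev_rcons /=.
case: (rev_ends (rev e)) => vi vt; rewrite revK.
by case: c cN => //= _ [] -> [] -> // h1 h2;
  (case: (new _ h1) || case: (new _ h2)).
Qed.

Lemma incident_both v e f c d : ~~ base c -> ~~ base d -> size e = size f ->
  e <> f -> incident v (rcons e c) -> incident v (rcons f d) ->
  incident v e /\ incident v f.
Proof.
move=> cN dN sz ef /incident_rcons-/(_ cN) ve /incident_rcons-/(_ dN) vf.
case: ve vf => [ve|[k ->]] [vf|[j]].
- by [].
- by move=> vE; move: ve; rewrite vE => /size_new; rewrite sz ltnn.
- by move: vf => /size_new; rewrite sz ltnn.
- by case.
Qed.

Lemma equivalent_refl x : equivalent x x.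
Proof. by move=> n; exists (source (prefix x n.+1)); left. Qed.

Lemma equivalent_sym x y : equivalent x y -> equivalent y x.
Proof. by move=> xy n; have [v vx vy] := xy n; exists v. Qed.

Lemma equivalent_trans y x z :
  equivalent x y -> equivalent y z -> equivalent x z.
Proof.
move=> xy yz n; apply: contrapT => xzN.
have sz (s t : Omega) : size (prefix s n.+1) = size (prefix t n.+1).
  by rewrite !size_mkseq.
have xyN : prefix x n.+1 <> prefix y n.+1.
  by move=> E; apply: xzN; rewrite E; exact: yz.
have yzN : prefix y n.+1 <> prefix z n.+1.
  by move=> E; apply: xzN; rewrite -E; exact: xy.
have [v] := xy n.+1; have [w] := yz n.+1.
rewrite !(prefixS _ n.+1) => wy wz vx vy.
have [vx' vy'] := incident_both (letters_nbase x n) (letters_nbase y n)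
  (sz _ _) xyN vx vy.
have [wy' wz'] := incident_both (letters_nbase y n) (letters_nbase z n)
  (sz _ _) yzN wy wz.
by apply: xzN; exists v => //; rewrite (rcons_ends (letters_nbase y n) vy wy).
Qed.

Definition equivalentb (x y : Omega) : bool := `[< equivalent x y >].

Lemma equivalentb_refl : reflexive equivalentb.
Proof. by move=> x; apply/asboolP; exact: equivalent_refl. Qed.

Lemma equivalentb_sym : symmetric equivalentb.
Proof. by move=> x y; apply/asboolP/asboolP; exact: equivalent_sym. Qed.

Lemma equivalentb_trans : transitive equivalentb.
Proof.
by move=> y x z /asboolP xy /asboolP yz; apply/asboolP/(equivalent_trans xy yz).
Qed.

Definition gluing :=
  EquivRel equivalentb equivalentb_refl equivalentb_sym equivalentb_trans.

Definition airplane_quot := {eq_quot gluing}.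
HB.instance Definition _ := Quotient.on airplane_quot.

Definition airplane : Type := quotient_topology airplane_quot.
HB.instance Definition _ := Topological.on airplane.
HB.instance Definition _ := Quotient.on airplane.

Definition point_of (x : Omega) : airplane := \pi_airplane x.

Definition vertex_point (v : vertex) (p : airplane) : Prop :=
  exists2 x, point_of x = p &
    exists N, forall n, (N <= n)%N -> incident v (prefix x n).

Definition starts_with (e : word) (x : Omega) : Prop := prefix x (size e) = e.

Definition cell (e : word) : set airplane := point_of @` starts_with e.

Section Homeo.
Variable X : topologicalType.

Record homeo := Homeo {
  homeo_fun :> X -> X;
  homeo_inv : X -> X;
  homeo_funK : cancel homeo_fun homeo_inv;
  homeo_invK : cancel homeo_inv homeo_fun;
  homeo_fun_continuous : continuous homeo_fun;
  homeo_inv_continuous : continuous homeo_inv }.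

Lemma homeo_ext (f g : homeo) : f =1 g -> f = g.
Proof.
case: f g => f f' fK f'K fc f'c [g g' gK g'K gc g'c] /= /funext fg.
have fg' : f' = g' by apply/funext => x; rewrite -{1}(g'K x) -fg fK.
by subst g g'; congr Homeo; exact: Prop_irrelevance.
Qed.

Definition homeo_one : homeo :=
  @Homeo id id (fun=> erefl) (fun=> erefl) (fun=> cvg_id) (fun=> cvg_id).

Definition homeo_inverse (f : homeo) : homeo :=
  Homeo (@homeo_invK f) (@homeo_funK f)
    (@homeo_inv_continuous f) (@homeo_fun_continuous f).

Definition homeo_comp (f g : homeo) : homeo :=
  @Homeo (f \o g) (homeo_inv g \o homeo_inv f)
    (can_comp (@homeo_funK f) (@homeo_funK g))
    (can_comp (@homeo_invK g) (@homeo_invK f))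
    (fun x => continuous_comp
       (@homeo_fun_continuous g x) (@homeo_fun_continuous f _))
    (fun x => continuous_comp
       (@homeo_inv_continuous f x) (@homeo_inv_continuous g _)).

HB.instance Definition _ := gen_eqMixin homeo.
HB.instance Definition _ := gen_choiceMixin homeo.

Lemma homeo_compA : associative homeo_comp.
Proof. by move=> f g h; exact: homeo_ext. Qed.
Lemma homeo_comp1f : left_id homeo_one homeo_comp.
Proof. by move=> f; exact: homeo_ext. Qed.
Lemma homeo_compf1 : right_id homeo_one homeo_comp.
Proof. by move=> f; exact: homeo_ext. Qed.
Lemma homeo_compVf : left_inverse homeo_one homeo_inverse homeo_comp.
Proof. by move=> f; apply: homeo_ext => x /=; exact: homeo_funK. Qed.
Lemma homeo_compfV : right_inverse homeo_one homeo_inverse homeo_comp.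
Proof. by move=> f; apply: homeo_ext => x /=; exact: homeo_invK. Qed.

HB.instance Definition _ := isGroup.Build homeo
  homeo_compA homeo_comp1f homeo_compf1 homeo_compVf homeo_compfV.

End Homeo.

Definition generated (G : groupType) (S : set G) : set G :=
  smallest [set H : set G | group_closed [in H]] S.

(* To be used for a subgroup [H]; then it says that [H] is the subgroup
   generated by some finite subset. *)
Definition finitely_generated (G : groupType) (H : set G) : Prop :=
  exists S : set G, [/\ finite_set S, S `<=` H & H `<=` generated S].

(* [x] and [y] range over the pairs of words of the form [ew], [e'w]. *)
Definition canonical_on (f : airplane -> airplane) (e e' : word) : Prop :=
  forall x y : Omega, starts_with e x -> starts_with e' y ->
    (forall n, letters x (size e + n) = letters y (size e' + n)) ->
    f (point_of x) = point_of y.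

Definition cellular_partition (P : {fset word}) : Prop :=
  [/\ forall e, e \in P -> edge e,
      \bigcup_(e in [set` P]) cell e = setT
    & trivIset [set` P] (fun e => (cell e)°)].

Definition T_A : set (homeo airplane) :=
  [set f | exists2 P, cellular_partition P & forall e, e \in P ->
     exists e', [/\ edge e', is_red e' = is_red e & canonical_on f e e']].

(* Only the values of [emap] on the edges of [dom] and of [vmap] on its vertices
   are meaningful. *)
Record diagram := Diagram {
  dom : {fset word};
  cod : {fset word};
  emap : word -> word;
  vmap : vertex -> vertex }.

Definition preserves_direction (d : diagram) (e : word) : Prop :=
  source (emap d e) = vmap d (source e) /\
  target (emap d e) = vmap d (target e).

Definition reverses_direction (d : diagram) (e : word) : Prop :=
  source (emap d e) = vmap d (target e) /\
  target (emap d e) = vmap d (source e).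

Definition isomorphism (d : diagram) : Prop :=
  [/\ set_bij [set` dom d] [set` cod d] (emap d),
      set_bij (vertices (dom d)) (vertices (cod d)) (vmap d)
    & forall e, e \in dom d -> is_red (emap d e) = is_red e /\
        (preserves_direction d e \/ ~~ is_red e /\ reverses_direction d e)].

Definition flip (c : letter) : letter :=
  match c with bm => bp | bp => bm | up => dn | dn => up | _ => c end.

Definition flipped_on (f : airplane -> airplane) (e e' : word) : Prop :=
  forall c, c \in replacement (last eL e) ->
    canonical_on f (rcons e c) (rcons e' (flip c)).

Definition graph_pair_diagram (f : homeo airplane) (d : diagram) : Prop :=
  [/\ expansion (dom d), expansion (cod d), isomorphism d
    & forall e, e \in dom d ->
        (preserves_direction d e -> canonical_on f e (emap d e)) /\
        (reverses_direction d e -> flipped_on f e (emap d e))].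

(* [d'] is obtained from [d] by expanding [e] and its image. The values of
   [vmap d'] at the two new vertices are determined by [isomorphism d']. *)
Definition diagram_expansion (d : diagram) (e : word) (d' : diagram) : Prop :=
  [/\ dom d' = replace_edge (dom d) e,
      cod d' = replace_edge (cod d) (emap d e),
      forall v, vertices (dom d) v -> vmap d' v = vmap d v,
      forall e', e' \in dom d -> e' != e -> emap d' e' = emap d e'
    & forall c, c \in replacement (last eL e) ->
        (preserves_direction d e ->
           emap d' (rcons e c) = rcons (emap d e) c) /\
        (reverses_direction d e ->
           emap d' (rcons e c) = rcons (emap d e) (flip c))].

Definition reduced_diagram (f : homeo airplane) (d : diagram) : Prop :=
  graph_pair_diagram f d /\
  ~ exists d0 e, [/\ graph_pair_diagram f d0, e \in dom d0
                   & diagram_expansion d0 e d].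

Definition radial (e : word) : bool :=
  edge e && (last sr e \in [:: eL; eR; sr]).

Definition external_extremes : set airplane :=
  [set p | exists2 e, radial e & vertex_point (target e) p].

(* For a blue edge [e ++ t] with [e] radial and [t] a word in [bm], [bp], the
   exponent is the size of [t]. *)
Definition edge_length (e : word) : rat :=
  (2%:R^-1 ^+ find (fun c => c \notin [:: bm; bp]) (rev e))%R.

Definition endpoint (p : airplane) (e : word) : Prop :=
  exists2 v, incident v e & vertex_point v p.

(* [D_p(f) = q]: the graph of the function [D], which is single-valued because
   the reduced diagram of [f] is unique. *)
Definition extremal_derivative (f : homeo airplane) (p : airplane) (q : rat) :
    Prop :=
  exists2 d, reduced_diagram f d &
    (~ (exists2 e, e \in dom d & endpoint p e) /\ q = 1%R) \/
    (exists e, [/\ e \in dom d, endpoint p e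
       & q = (edge_length (emap d e) / edge_length e)%R]).

Definition E : set (homeo airplane) :=
  [set f | T_A f /\
     forall p, external_extremes p -> extremal_derivative f p 1%R].

(* Main.v *)
From HB Require Import structures.
From mathcomp Require Import all_boot all_order all_algebra generic_quotient.
From mathcomp Require Import finmap.
From mathcomp Require Import all_classical topology.
Require Import Defs.

Set Implicit Arguments.
Unset Strict Implicit.
Unset Printing Implicit Defensive.

Local Open Scope classical_set_scope.
Local Open Scope quotient_scope.

(** Every rearrangement permutes the external extremes, and near the tip of the
    ray of a radial edge rho it maps the cells of rho b_+^(k+i) canonically to
    those of rho' b_+^(j+i), for some radial edge rho' and fixed k, j. The
    extremal derivative at the tip is 2^(k-j). So an element of [E] is one that,
    far enough along each ray, does not change depths. A graph pair diagram has
    finitely many edges, so one depth n serves all the rays, for the element and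
    its inverse ([E_keeps_rays]). For a fixed n, the homeomorphisms that do so
    form a group [ray_subgroup n], and these groups increase with n; hence a
    finite subset of [E] generates a group inside one of them.

    It remains to find, for each n, an element of [E] outside [ray_subgroup n].
    A copy of the generator x_0 of Thompson's group F supported in the cell of
    e_L b_+^n b_- will do: it is the identity near the tip of the ray of e_L
    and subdivides no other ray near its tip, but it moves the part of the ray
    of e_L just beyond depth n ([shift_in_E], [shift_moves]).

    Three facts carry this out. An external extreme has a single name
    ([extreme_equivalent]), so words can be recovered from points, and in
    particular the shift j - k depends only on the homeomorphism
    ([canonical_ray_inj]); this is why the computations need not be made in
    reduced diagrams. A tip that is a vertex of an expansion has degree one
    there ([incident_extreme]), and all vertices of degree one are tips
    ([expansion_degree]), so an isomorphism of expansions sends tips to tips and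
    cannot reverse the edge that ends there ([diagram_ray]). Finally, every
    isomorphism between expansions is the diagram of a homeomorphism
    ([diagram_realization]): it acts on names by replacing prefixes, and
    different names of one point are names of a common vertex ([shared_vertex]),
    around which the isomorphism moves all edges coherently. *)

(** * Words and their endpoints *)

Definition child (c d : letter) : bool := d \in replacement c.

Lemma child_red c c' d : red c' = red c -> child c' d = child c d.
Proof. by rewrite /child /replacement => ->. Qed.

Lemma child_nbase c d : child c d -> ~~ base d.
Proof. exact: replacement_nbase. Qed.

Lemma child_flip c d : child c (flip d) = child c d.
Proof. by case: c; case: d. Qed.

Lemma red_flip c : red (flip c) = red c.
Proof. by case: c. Qed.

Lemma flipK : involutive flip.
Proof. by case. Qed.

Lemma is_red_rcons e c : is_red (rcons e c) = red c.
Proof. by rewrite /is_red last_rcons. Qed.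

Lemma edge_neq0 e : edge e -> e <> [::].
Proof. by case: e. Qed.

Lemma edge_cat e t : e <> [::] ->
  edge (e ++ t) = edge e && path child (last eL e) t.
Proof. by case: e => //= c e _; rewrite cat_path andbA. Qed.

Lemma edge_rcons e c : e <> [::] ->
  edge (rcons e c) = edge e && child (last eL e) c.
Proof. by move=> e0; rewrite -cats1 edge_cat //= andbT. Qed.

Lemma edge_catW e t : e <> [::] -> edge (e ++ t) -> edge e.
Proof. by move=> e0; rewrite edge_cat // => /andP[]. Qed.

Lemma path_child_red c c' t :
  red c' = red c -> path child c' t = path child c t.
Proof. by move=> cc'; case: t => //= d t; rewrite (child_red _ cc'). Qed.

(** What may follow an edge depends on its colour alone; this is what makes
    canonical homeomorphisms between cells of one colour total. *)
Lemma edge_graft e e' t : edge e -> edge e' -> is_red e' = is_red e ->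
  edge (e' ++ t) = edge (e ++ t).
Proof.
move=> ee ee' col; rewrite !edge_cat ?ee ?ee' /=; try exact: edge_neq0.
exact: path_child_red.
Qed.

Definition child_ends (e : word) (c : letter) : vertex * vertex :=
  match c with
  | eL => (va, vl) | eR => (vb, vr) | eU => (vb, va) | eD => (va, vb)
  | r1 => (source e, New e nm) | r2 => (New e nm, target e)
  | sr => (New e nm, New e nw)
  | bm => (New e nx, source e) | bp => (New e ny, target e)
  | up => (New e ny, New e nx) | dn => (New e nx, New e ny)
  end.

Lemma source_rcons e c : source (rcons e c) = (child_ends e c).1.
Proof.
rewrite /source rev_rcons /= /child_ends /source /target.
by case: (rev_ends (rev e)) => vi vt; rewrite revK; case: c.
Qed.

Lemma target_rcons e c : target (rcons e c) = (child_ends e c).2.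
Proof.
rewrite /target rev_rcons /= /child_ends /source /target.
by case: (rev_ends (rev e)) => vi vt; rewrite revK; case: c.
Qed.

Definition endsE := (source_rcons, target_rcons).

Lemma new_prefix w k e : incident (New w k) e -> exists c t, e = w ++ c :: t.
Proof.
elim/last_ind: e => [|e c IH]; first by case.
have cons v : incident v e -> v = New w k ->
    exists c' t, rcons e c = w ++ c' :: t.
  move=> vi vE; move: IH; rewrite -vE => /(_ vi)[c' [t] ->].
  by exists c', (rcons t c); rewrite rcons_cat.
rewrite /incident !endsE /=.
have self : exists c' t, rcons e c = e ++ c' :: t.
  by exists c, [::]; rewrite cats1.
by case: c cons self => cons self [] //= E;
  (try by case: E => -> _); apply: (cons _ _ (esym E)); rewrite /incident; auto.
Qed.

Lemma new_notin w k : ~ incident (New w k) w.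
Proof. by move=> /size_new; rewrite ltnn. Qed.

Lemma source_neq_target e c : source (rcons e c) <> target (rcons e c).
Proof.
have nS k : source e <> New e k by move=> E; apply: (@new_notin e k); left.
have nT k : target e <> New e k by move=> E; apply: (@new_notin e k); right.
by rewrite !endsE; case: c => //= E; (try by case: (nS _ E));
   (try by case: (nT _ E)); (try by case: (nS _ (esym E)));
   case: (nT _ (esym E)).
Qed.

Lemma edge_noloop e : edge e -> source e <> target e.
Proof. by case/lastP: e => // e c _; exact: source_neq_target. Qed.

(** * External extremes *)

(** For a radial edge [rho], the piece of [rho] that still reaches its terminal
    vertex after [k] replacements. *)
Definition ray (rho : word) (k : nat) : word := rho ++ nseq k bp.

Lemma ray0 rho : ray rho 0 = rho.
Proof. exact: cats0. Qed.

Lemma rayS rho k : ray rho k.+1 = rcons (ray rho k) bp.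
Proof. by rewrite /ray -addn1 nseqD catA cats1. Qed.

Lemma rayD rho k j : ray rho k ++ nseq j bp = ray rho (k + j).
Proof. by rewrite /ray -catA nseqD. Qed.

Lemma size_ray rho k : size (ray rho k) = size rho + k.
Proof. by rewrite size_cat size_nseq. Qed.

Lemma radial_cases rho : radial rho ->
  [\/ rho = [:: eL], rho = [:: eR] | exists2 r, edge r & rho = rcons r sr].
Proof.
case/andP; case/lastP: rho => // r c; rewrite last_rcons.
have [->|r0] := r =P [::].
  by rewrite /= andbT; case: c => // _ _; [apply: Or31 | apply: Or32].
rewrite edge_rcons // => /andP[er] /child_nbase cN cR; apply: Or33.
by exists r => //; case: c cN cR.
Qed.

Lemma radial_edge rho : radial rho -> edge rho.
Proof. by case/andP. Qed.

Lemma radial_blue rho : radial rho -> is_red rho = false.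
Proof. by case/radial_cases=> [->|->|[r _ ->]]; rewrite ?is_red_rcons. Qed.

Lemma ray_blue rho k : radial rho -> is_red (ray rho k) = false.
Proof.
move=> rr; case: k => [|k]; first by rewrite ray0 radial_blue.
by rewrite rayS is_red_rcons.
Qed.

Lemma ray_edge rho k : radial rho -> edge (ray rho k).
Proof.
move=> rr; elim: k => [|k IH]; first by rewrite ray0 radial_edge.
rewrite rayS edge_rcons ?IH /=; last exact: edge_neq0.
by rewrite /child /replacement; move: (ray_blue k rr); rewrite /is_red => ->.
Qed.

Lemma target_ray rho k : target (ray rho k) = target rho.
Proof. by elim: k => [|k IH]; rewrite ?ray0 // rayS target_rcons. Qed.

Lemma source_ray_neq rho k : radial rho -> source (ray rho k) <> target rho.
Proof.
by move=> rr E; case: (edge_noloop (ray_edge k rr)); rewrite E target_ray.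
Qed.

(** The edges meeting an external extreme are its ray truncated at the outer
    end: no replacement rule ever attaches a second edge there, and a
    replaced blue edge keeps its terminal vertex on its last piece. *)
Lemma incident_extreme rho g : radial rho -> edge g ->
  incident (target rho) g -> exists k, g = ray rho k.
Proof.
move=> rr; have base_case c : base c -> incident (target rho) [:: c] ->
    [:: c] = ray rho 0.
  rewrite ray0; case/radial_cases: rr => [->|->|[r er ->]].
  - by case: c => // _ [].
  - by case: c => // _ [].
  - by rewrite /incident target_rcons; case: c => // _ [].
elim/last_ind: g => // g c IH.
have [->|g0] := g =P [::].
  by move=> /=; rewrite andbT => cb /(base_case _ cb) ->; exists 0.
rewrite edge_rcons // => /andP[eg gc].
have {}IH : incident (target rho) g ->
    [/\ exists k, g = ray rho k, is_red g = false, target rho = target g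
      & target rho <> source g].
  move=> /(IH eg)[k gk]; split; first by exists k.
  - by rewrite gk ray_blue.
  - by rewrite gk target_ray.
  - by rewrite gk => /esym; exact: source_ray_neq.
have nred : incident (target rho) g -> red c -> c \in [:: up; dn].
  move=> /IH[_ + _ _]; rewrite /is_red => gb.
  by move: gc; rewrite /child /replacement gb; case: (c).
have nsource : target rho <> source g.
  by move=> E; have [] := IH (or_introl E).
have new k : target rho = New g k -> k = nw /\ rho = rcons g sr.
  case: (radial_cases rr) => [->|->|[r er ->]]; rewrite ?target_rcons //=.
  by move=> -[-> <-].
rewrite /incident !endsE; have := child_nbase gc.
case: c gc nred => // gc nred _ [] /= E; try by [case: (nsource E)];
  try by [have [] := new _ E].
- by have /nred-/(_ isT) : incident (target rho) g by right.
- by exists 0; rewrite ray0; have [_ ->] := new _ E.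
- have [[k gk] _ _ _] := IH (or_intror E).
  by exists k.+1; rewrite rayS gk.
Qed.

(** A radial edge is recovered from its ray by stripping the final letters
    [bp], because a radial edge does not itself end with [bp]. *)
Lemma ray_prefix rho rho' k t : radial rho -> radial rho' ->
  ray rho k = rho' ++ t -> exists s, rho = rho' ++ s.
Proof.
move=> rr rr' E.
have [le|lt] := leqP (size rho') (size rho).
  exists (drop (size rho') rho); rewrite -{1}(cat_take_drop (size rho') rho).
  congr cat; have := congr1 (take (size rho')) E.
  by rewrite take_size_cat // takel_cat.
have : last eL rho' \in nseq k bp.
  have := congr1 (take (size rho')) E.
  rewrite take_size_cat // take_cat ltnNge (ltnW lt) /=.
  move=> <-; rewrite last_cat.
  set s := take _ _; have : s != [::].
    rewrite -size_eq0 size_take size_nseq; have := congr1 size E.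
    rewrite !size_cat size_nseq => E'.
    have k1 : size rho' - size rho <= k by rewrite leq_subLR E' leq_addr.
    by case: ltnP => _; rewrite -lt0n; [|apply: leq_trans k1]; rewrite subn_gt0.
  move=> s0; apply: (@mem_take (size rho' - size rho)); rewrite -/s.
  by case/lastP: s s0 => // s c _; rewrite last_rcons mem_rcons in_cons eqxx.
rewrite mem_nseq => /andP[_ /eqP lb].
by case/andP: rr' => _; rewrite -[last sr _](@last_cons _ eL) /=;
   case: (rho') lb => //= c r ->.
Qed.

Lemma ray_inj rho rho' k j : radial rho -> radial rho' ->
  ray rho k = ray rho' j -> rho = rho' /\ k = j.
Proof.
move=> rr rr' E; have [s rE] := ray_prefix rr rr' E.
have [s' rE'] := ray_prefix rr' rr (esym E).
have s0 : s = [::].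
  apply: size0nil; apply/eqP; move: (congr1 size rE) (congr1 size rE').
  rewrite !size_cat => -> /eqP; rewrite -addnA -[X in X == _]addn0 eqn_add2l.
  by rewrite eq_sym addn_eq0 => /andP[].
move: rE; rewrite s0 cats0 => rE; split=> //.
by have := congr1 size E; rewrite !size_ray rE => /addnI.
Qed.
(** * Points of the limit space *)

Definition tail (m : nat) (x : Omega) (n : nat) : word :=
  mkseq (fun i => letters x (m + i)) n.

Lemma mkseqD (T : Type) (w : nat -> T) m n :
  mkseq w (m + n) = mkseq w m ++ mkseq (fun i => w (m + i)) n.
Proof.
by rewrite /mkseq iotaD map_cat add0n -{2}(addn0 m) iotaDl -map_comp.
Qed.

Lemma take_mkseq (T : Type) (w : nat -> T) m n : m <= n ->
  take m (mkseq w n) = mkseq w m.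
Proof. by move=> le; rewrite -(subnKC le) mkseqD take_size_cat ?size_mkseq. Qed.

Lemma prefixD x m n : prefix x (m + n) = prefix x m ++ tail m x n.
Proof. exact: mkseqD. Qed.

Lemma size_prefix x n : size (prefix x n) = n.
Proof. exact: size_mkseq. Qed.

Lemma take_prefix x m n : m <= n -> take m (prefix x n) = prefix x m.
Proof. exact: take_mkseq. Qed.

Lemma prefix_inj x y : (forall n, prefix x n = prefix y n) -> x = y.
Proof.
move=> xy; apply: val_inj; apply/funext => n; have := xy n.+1.
by rewrite !prefixS => /rcons_inj[].
Qed.

Lemma prefix_neqW x y m n : m <= n -> prefix x m <> prefix y m ->
  prefix x n <> prefix y n.
Proof. by move=> le + xy; apply; rewrite -(take_prefix x le) xy take_prefix. Qed.

Lemma point_eqP x y : point_of x = point_of y <-> equivalent x y.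
Proof.
have E : (equivalentb x y : Prop) <-> point_of x = point_of y.
  by split=> /(@eqmodP _ gluing x y).
by rewrite -E; split=> /asboolP.
Qed.

Lemma starts_with_cat e t x : starts_with (e ++ t) x -> starts_with e x.
Proof.
rewrite /starts_with size_cat => xE.
by rewrite -(take_prefix x (leq_addr (size t) (size e))) xE take_size_cat.
Qed.

Lemma starts_with_prefix x n : starts_with (prefix x n) x.
Proof. by rewrite /starts_with size_prefix. Qed.

Lemma starts_with_edge e x : e <> [::] -> starts_with e x -> edge e.
Proof. by case: e => // c e _ <-; exact: edge_prefix. Qed.

Lemma starts_with_comparable e e' x : starts_with e x -> starts_with e' x ->
  size e <= size e' -> exists t, e' = e ++ t.
Proof.
move=> ex ex' le; exists (tail (size e) x (size e' - size e)).
by rewrite -{1}ex' -{1}(subnKC le) prefixD ex.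
Qed.

Lemma point_exists e (w : nat -> letter) : e <> [::] ->
  (forall n, edge (e ++ mkseq w n)) ->
  exists2 x, starts_with e x & forall n, letters x (size e + n) = w n.
Proof.
move=> e0 ew.
pose s n := if n < size e then nth eL e n else w (n - size e).
have sE n : mkseq s (size e + n) = e ++ mkseq w n.
  rewrite mkseqD; congr cat.
    apply: (@eq_from_nth _ eL) => [|i]; rewrite size_mkseq // => lt.
    by rewrite nth_mkseq // /s lt.
  apply: eq_mkseq => i; rewrite /s /=.
  by rewrite ltnNge leq_addr addKn.
have sP : s \in [set x : letter_seq | forall n, edge (mkseq x n.+1)].
  apply: mem_set => n; have := ew n.+1; rewrite -sE addnC mkseqD.
  exact: edge_catW.
exists (SigSub sP : Omega).
  by have := sE 0; rewrite addn0 cats0.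
move=> n; have -> : letters (SigSub sP) (size e + n) = s (size e + n) by [].
by rewrite /s ltnNge leq_addr addKn.
Qed.

Definition same_tail (e e' : word) (x y : Omega) : Prop :=
  [/\ starts_with e x, starts_with e' y
    & forall n, letters x (size e + n) = letters y (size e' + n)].

Lemma same_tail_sym e e' x y : same_tail e e' x y -> same_tail e' e y x.
Proof. by move=> [ex ey xy]; split=> // n; rewrite xy. Qed.

Lemma same_tail_prefix e e' x y n : same_tail e e' x y ->
  prefix x (size e + n) = e ++ tail (size e) x n /\
  prefix y (size e' + n) = e' ++ tail (size e) x n.
Proof.
move=> [ex ey xy]; rewrite !prefixD ex ey; split=> //; congr cat.
by apply: eq_mkseq => i; rewrite xy.
Qed.

Lemma same_tail_fun e e' x y z : same_tail e e' x y -> same_tail e e' x z ->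
  y = z.
Proof.
move=> xy xz; apply: prefix_inj => n.
have [le|/ltnW le] := leqP (size e') n; last first.
  rewrite -(take_prefix y le) -(take_prefix z le).
  by have [_ -> _] := xy; have [_ -> _] := xz.
rewrite -(subnKC le); have [_ ->] := same_tail_prefix (n - size e') xy.
by have [_ ->] := same_tail_prefix (n - size e') xz.
Qed.

(** Canonical homeomorphisms restrict to canonical homeomorphisms of smaller
    cells. *)
Lemma same_tail_cat e e' t x y : starts_with (e ++ t) x ->
  same_tail e e' x y <-> same_tail (e ++ t) (e' ++ t) x y.
Proof.
move=> etx; split=> xy.
  have [_ yE] := same_tail_prefix (size t) xy.
  have [_ _ xyn] := xy; split=> // [|n].
    rewrite /starts_with size_cat yE; congr cat.
    by have := etx; rewrite /starts_with size_cat prefixD (starts_with_cat etx) =>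
      /eqP; rewrite eqseq_cat // eqxx => /eqP.
  by rewrite !size_cat -!addnA xyn.
have [_ ey xyn] := xy.
split=> [||n]; [exact: starts_with_cat etx | exact: starts_with_cat ey | ].
have [lt|le] := ltnP n (size t); last first.
  by have := xyn (n - size t); rewrite !size_cat -!addnA subnKC.
have nthE z g : starts_with (g ++ t) z -> letters z (size g + n) = nth eL t n.
  rewrite /starts_with => /(congr1 (fun s => nth eL s (size g + n))).
  rewrite nth_mkseq ?size_cat ?ltn_add2l // nth_cat ltnNge leq_addr /=.
  by rewrite addKn.
by rewrite (nthE _ _ etx) (nthE _ _ ey).
Qed.

Lemma graft_exists e e' x : edge e -> edge e' -> is_red e' = is_red e ->
  starts_with e x -> exists y, same_tail e e' x y.
Proof.
move=> ee ee' col ex.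
have [n|y ey yE] := @point_exists e' (fun n => letters x (size e + n))
    (edge_neq0 ee').
  rewrite (edge_graft _ ee ee' col).
  have := prefixD x (size e) n; rewrite ex /tail => <-.
  by case: (e) ee => // c e0 _; exact: edge_prefix.
by exists y; split=> // n; rewrite yE.
Qed.

(** [x] is the name [rho bp bp bp] and so on of the terminal vertex of [rho]. *)
Definition extreme (rho : word) (x : Omega) : Prop :=
  forall n, prefix x (size rho + n) = ray rho n.

Lemma extreme_starts rho x k : extreme rho x -> starts_with (ray rho k) x.
Proof. by move=> ex; rewrite /starts_with size_ray. Qed.

Lemma extreme_exists rho : radial rho -> exists x, extreme rho x.
Proof.
move=> rr; have r0 := edge_neq0 (radial_edge rr).
have [n|x xr xE] := @point_exists rho (fun=> bp) r0.
  have -> : mkseq (fun=> bp) n = nseq n bp.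
    by elim: n => // n IH; rewrite mkseqS IH -cats1 -(addn1 n) nseqD.
  exact: ray_edge.
exists x => n; rewrite prefixD xr; congr cat.
elim: n => // n IH; rewrite /tail mkseqS -/(tail _ x n) IH xE.
by rewrite -cats1 -(addn1 n) nseqD.
Qed.

(** Two different names of one point are names of a vertex. Once the prefixes
    differ, a vertex common to the next prefixes is already common to them, and
    an edge shares only one vertex with its parent; so the common vertices do
    not change any more. *)
Lemma shared_vertex x y N : 0 < N -> prefix x N <> prefix y N ->
  equivalent x y -> exists v, forall n, N <= n ->
    incident v (prefix x n) /\ incident v (prefix y n).
Proof.
move=> N0 neq xy.
pose shares v n := incident v (prefix x n) /\ incident v (prefix y n).
have down v n : N <= n -> shares v n.+1 -> shares v n.
  case: n => [|n] le; first by move: N0; rewrite ltnNge le.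
  rewrite /shares !(prefixS _ n.+1) => -[vx vy].
  apply: incident_both vx vy; rewrite ?size_prefix //; try exact: letters_nbase.
  exact: prefix_neqW neq.
have downs v m n : N <= n <= m -> shares v m -> shares v n.
  case/andP=> Nn nm; rewrite -(subnK nm); elim: (m - n) => // k IH.
  by rewrite addSn => /down; rewrite (leq_trans Nn) ?leq_addl // => /(_ isT).
have ex n : exists v, shares v n.+1 by have [v] := xy n; exists v.
have [v [vx vy]] := ex N; exists v => n Nn.
have [w wn] := ex n; suff <- : w = v by apply: downs wn; rewrite Nn leqnSn.
have [wx _] : shares w N.+1 by apply: downs wn; rewrite leqnSn ltnS.
have [wx' _] : shares w N by apply: downs wn; rewrite leqnn ltnW.
have [vx' _] : shares v N by apply: (@downs _ N.+1); rewrite ?leqnn ?leqnSn.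
case: N N0 {neq down downs Nn} vx wx vx' wx' {vy} => // N _.
rewrite (prefixS x N.+1) => vx wx vx' wx'.
exact: rcons_ends (letters_nbase x N) wx vx wx' vx'.
Qed.

(** The argument of [shared_vertex] read backwards: common vertices are
    inherited by shorter prefixes. *)
Lemma eventually_adjacent x y N :
  (forall n, N <= n -> adjacent (prefix x n) (prefix y n)) -> equivalent x y.
Proof.
elim: N => [|N IH] xyN; first by move=> n; exact: xyN.
apply: IH => n; rewrite leq_eqVlt => /orP[/eqP<-{n}|]; last exact: xyN.
have [->|neq] := pselect (prefix x N = prefix y N).
  by exists (source (prefix y N)); left.
have [v] := xyN N.+1 (leqnn _).
case: N neq {xyN} => [//|N] neq; rewrite !(prefixS _ N.+1) => vx vy.
have sz : size (prefix x N.+1) = size (prefix y N.+1) by rewrite !size_prefix.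
have [vx' vy'] :=
  incident_both (letters_nbase x N) (letters_nbase y N) sz neq vx vy.
by exists v.
Qed.

(** An external extreme has a single name, since no two rays share a tip. *)
Lemma extreme_equivalent rho x y : radial rho -> extreme rho x ->
  equivalent x y -> y = x.
Proof.
move=> rr xr xy; apply: prefix_inj => n; apply: contrapT => neqC.
have neq : prefix x n <> prefix y n by move/esym.
have neq' : prefix x n.+1 <> prefix y n.+1 by apply: prefix_neqW neq.
have [//|v vxy] := shared_vertex _ neq' xy.
have [vx _] := vxy (size rho + n.+1) (leq_addl _ _).
have [vx' vy] := vxy (size rho + n.+2) (leq_trans (leqnSn _) (leq_addl _ _)).
have vE : v = target rho.
  move: vx vx'; rewrite !xr (rayS _ n.+1) /incident !endsE /= !target_ray.
  move=> vx [vE|->] //; case: (@new_notin (ray rho n.+1) ny).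
  by rewrite -vE /incident target_ray.
rewrite vE addnS in vy; have [k yE] := incident_extreme rr (edge_prefix _ _) vy.
case: (prefix_neqW (leq_addl (size rho) n.+2) (prefix_neqW (leqnSn n.+1) neq')).
rewrite xr addnS yE; congr ray; apply/eqP; rewrite -(eqn_add2l (size rho)).
by rewrite -!size_ray -yE size_prefix size_ray addnS.
Qed.

Lemma extreme_inj rho rho' x : radial rho -> radial rho' ->
  extreme rho x -> extreme rho' x -> rho = rho'.
Proof.
move=> rr rr' xr xr'.
have E : ray rho (size rho') = ray rho' (size rho).
  by rewrite -xr -xr' addnC.
by have [] := ray_inj rr rr' E.
Qed.
(** * Expansions *)

Lemma replace_edgeP D e g : g \in replace_edge D e <->
  (g \in D /\ g <> e) \/ exists2 c, child (last eL e) c & g = rcons e c.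
Proof.
rewrite /replace_edge !inE; split.
  case/orP=> [/andP[/eqP ge gD]|/mapP[c cc ->]]; first by left.
  by right; exists c.
case=> [[gD /eqP ge]|[c cc ->]]; first by rewrite ge gD.
by apply/orP; right; apply: map_f.
Qed.

Lemma expansion_edge D e : expansion D -> e \in D -> edge e.
Proof.
move=> XD; elim: XD e => [e|{}D e0 _ IH e0D e].
  by rewrite !inE -!orbA => /or4P[] /eqP->.
case/replace_edgeP=> [[/IH]//|[c cc ->]].
by rewrite edge_rcons ?IH //; apply/edge_neq0/IH.
Qed.

Lemma expansion_cover D x : expansion D -> exists n, prefix x n \in D.
Proof.
elim=> [|{}D e0 XD [n nD] e0D].
  exists 1; have := edge_prefix x 0; rewrite prefixS /= andbT.
  by case: (letters x 0); rewrite !inE.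
have [E|ne] := prefix x n =P e0; last by exists n; apply/replace_edgeP; left.
exists n.+1; apply/replace_edgeP; right; exists (letters x n); last first.
  by rewrite prefixS E.
have := edge_prefix x n; rewrite prefixS edge_rcons ?E.
  by case/andP.
exact: edge_neq0 (expansion_edge XD e0D).
Qed.

(** The edges of an expansion cut the space of words into disjoint cylinders;
    together with [expansion_cover], every word has exactly one prefix among
    them. *)
Lemma expansion_unique D x m n : expansion D ->
  prefix x m \in D -> prefix x n \in D -> m = n.
Proof.
move=> XD; elim: XD m n => [m n|{}D e0 _ IH e0D m n].
  rewrite !inE -!orbA => /or4P[] /eqP/(congr1 size); rewrite size_prefix => ->;
    by move=> /or4P[] /eqP/(congr1 size); rewrite size_prefix => ->.
have old_new k j c : prefix x k \in D -> prefix x k <> e0 ->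
    prefix x j = rcons e0 c -> False.
  move=> kD ke; case: j => [|j]; first by case: (e0).
  rewrite prefixS => /rcons_inj[je _]; rewrite -je in e0D ke.
  by apply: ke; rewrite (IH _ _ kD e0D).
case/replace_edgeP=> [[mD me]|[c _ mc]]; case/replace_edgeP=> [[nD ne]|[d _ nd]].
- exact: IH.
- by case: (old_new m n d).
- by case: (old_new n m c).
- by rewrite -(size_prefix x m) -(size_prefix x n) mc nd !size_rcons.
Qed.

(** Points with a single name suffice to tell words apart, as every cell
    contains an external extreme. *)
Lemma edge_radial e : edge e -> exists t, radial (e ++ t).
Proof.
move=> ee; have e0 := edge_neq0 ee; case E: (is_red e).
  exists [:: sr]; rewrite /radial last_cat andbT edge_cat ?ee //=.
  by rewrite andbT /child /replacement -/(is_red e) E.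
exists [:: up; sr]; rewrite /radial last_cat andbT edge_cat ?ee //=.
by rewrite andbT /child /replacement -/(is_red e) E.
Qed.

Lemma edge_extreme e : edge e -> exists rho x,
  [/\ radial rho, extreme rho x & starts_with e x].
Proof.
case/edge_radial=> t rr; have [x xr] := extreme_exists rr.
exists (e ++ t), x; split=> //; apply: (@starts_with_cat _ t).
by rewrite -[_ ++ _]ray0; apply: extreme_starts.
Qed.

Lemma expansion_antichain D e t : expansion D -> e \in D -> e ++ t \in D ->
  t = [::].
Proof.
move=> XD eD etD; have [_ [x [_ _ ex]]] := edge_extreme (expansion_edge XD etD).
have ex' := starts_with_cat ex.
have := expansion_unique (x := x) (m := size e) (n := size (e ++ t)) XD.
rewrite ex ex' => /(_ eD etD)/eqP.
by rewrite size_cat -{1}(addn0 (size e)) eqn_add2l eq_sym => /eqP/size0nil.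
Qed.

Lemma expansion_child D e c : expansion D -> e \in D -> rcons e c \notin D.
Proof.
by move=> XD eD; apply/negP; rewrite -cats1 => /(expansion_antichain XD eD).
Qed.

Lemma edge_expansion e : edge e -> exists2 D, expansion D & e \in D.
Proof.
elim/last_ind: e => // e c IH; have [->|e0] := e =P [::].
  move=> ec; exists [fset [:: eL]; [:: eR]; [:: eU]; [:: eD]]%fset.
    exact: expansion_base.
  by move: ec; case: c => // _; rewrite !inE.
rewrite edge_rcons // => /andP[/IH[D XD eD] cc].
exists (replace_edge D e); first exact: expansion_replace.
by apply/replace_edgeP; right; exists c.
Qed.

Lemma card_replace_edge D e : expansion D -> e \in D ->
  #|` D| < #|` replace_edge D e|.
Proof.
move=> XD eD.
have [c [d [cc dd cd]]] :
    exists c d, [/\ child (last eL e) c, child (last eL e) d & c <> d].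
  by rewrite /child /replacement; case: red; [exists r1, r2 | exists bm, bp].
have cN := expansion_child c XD eD; have dN := expansion_child d XD eD.
apply: (@leq_trans #|` rcons e c |` (rcons e d |` (D `\ e))|%fset); last first.
  apply/fsubset_leq_card/fsubsetP => g gE; apply/replace_edgeP; move: gE.
  rewrite !inE => /or3P[/eqP->|/eqP->|/andP[/eqP ge gD]]; last by left.
  - by right; exists c.
  - by right; exists d.
rewrite (cardfsD1 e D) eD !cardfsU1 !inE (negPf cN) (negPf dN) !andbF !orbF.
have -> : (rcons e c == rcons e d) = false.
  by apply/eqP => /rcons_inj[].
by [].
Qed.

(** In an expansion, the only vertices of degree one are external extremes: new
    vertices other than the tip of a new radial edge are created with at least
    two edges, and an old vertex keeps an edge in place of every edge that is
    replaced. *)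
Lemma expansion_degree D e v : expansion D -> e \in D -> incident v e ->
  (exists2 rho, radial rho & v = target rho) \/
  exists e', [/\ e' \in D, e' <> e & incident v e'].
Proof.
move=> XD; elim: XD e v => [e v|{}D e0 XD IH e0D e v eD'].
  have mem c : base c ->
      [:: c] \in [fset [:: eL]; [:: eR]; [:: eU]; [:: eD]]%fset.
    by case: c => // _; rewrite !inE.
  rewrite !inE -!orbA => /or4P[] /eqP-> [] ->;
    do ?[by left; exists [:: eL] | by left; exists [:: eR]]; right;
    do ?[by exists [:: eU]; split; rewrite ?mem //; (left + right)
        |by exists [:: eD]; split; rewrite ?mem //; (left + right)].
have e0E := expansion_edge XD e0D.
have new c : child (last eL e0) c -> rcons e0 c \in replace_edge D e0.
  by move=> cc; apply/replace_edgeP; right; exists c.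
have old g : g \in D -> g <> e0 -> g \in replace_edge D e0.
  by move=> gD ge; apply/replace_edgeP; left.
have notin c : rcons e0 c \in D -> False by apply/negP/expansion_child.
have keep w : incident w e0 ->
    exists2 c, child (last eL e0) c & incident w (rcons e0 c).
  rewrite /incident /child /replacement; case: (red _) => -[->|->].
  - by exists r1 => //; left; rewrite endsE.
  - by exists r2 => //; right; rewrite endsE.
  - by exists bm => //; right; rewrite endsE.
  - by exists bp => //; right; rewrite endsE.
case/replace_edgeP: eD' => [[eD ee0] ve|[c cc -> ve]].
  have [|[e' [e'D e'e ve']]] := IH _ _ eD ve; first by left.
  right; have [E|ne] := e' =P e0; last by exists e'; split=> //; exact: old.
  move: ve'; rewrite E => /keep[c cc vc]; exists (rcons e0 c); split=> //.
    exact: new.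
  by move=> E'; apply: (notin c); rewrite E'.
have vold : incident v e0 -> (exists2 rho, radial rho & v = target rho) \/
  exists e', [/\ e' \in replace_edge D e0, e' <> rcons e0 c & incident v e'].
  move=> /(IH _ _ e0D)[|[e' [e'D e'e ve']]]; [by left | right].
  exists e'; split=> //; first exact: old.
  by move=> E; apply: (notin c); rewrite -E.
have vnew d : child (last eL e0) d -> d <> c -> incident v (rcons e0 d) ->
  (exists2 rho, radial rho & v = target rho) \/
  exists e', [/\ e' \in replace_edge D e0, e' <> rcons e0 c & incident v e'].
  move=> dd dc vd; right; exists (rcons e0 d); split=> //; first exact: new.
  by case/rcons_inj.
move: ve; rewrite /incident !endsE.
move: cc vold vnew; rewrite {1}/child /replacement; case E: (red _).
  have ch d : d \in [:: r1; r2; sr] -> child (last eL e0) d.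
    by rewrite /child /replacement E.
  rewrite !inE => /or3P[] /eqP-> vold vnew [] /= vE.
  - by apply: vold; left.
  - by apply: (vnew r2); rewrite ?ch // vE; left; rewrite endsE.
  - by apply: (vnew r1); rewrite ?ch // vE; right; rewrite endsE.
  - by apply: vold; right.
  - by apply: (vnew r1); rewrite ?ch // vE; right; rewrite endsE.
  - left; exists (rcons e0 sr); last by rewrite vE endsE.
    by rewrite /radial last_rcons andbT edge_rcons ?e0E ?ch //; apply: edge_neq0.
have ch d : d \in [:: bm; bp; up; dn] -> child (last eL e0) d.
  by rewrite /child /replacement E.
rewrite !inE => /or4P[] /eqP-> vold vnew [] /= vE.
- by apply: (vnew up); rewrite ?ch // vE; right; rewrite endsE.
- by apply: vold; left.
- by apply: (vnew up); rewrite ?ch // vE; left; rewrite endsE.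
- by apply: vold; right.
- by apply: (vnew bp); rewrite ?ch // vE; left; rewrite endsE.
- by apply: (vnew bm); rewrite ?ch // vE; left; rewrite endsE.
- by apply: (vnew bm); rewrite ?ch // vE; left; rewrite endsE.
- by apply: (vnew bp); rewrite ?ch // vE; left; rewrite endsE.
Qed.

(** * Topology *)

(** The sets containing a cylinder around [s] form a filter, and it converges
    to [s] since each coordinate is constant on a long enough cylinder. *)
Lemma nbhs_letter_seq (s : letter_seq) (U : set letter_seq) : nbhs s U ->
  exists n, forall y : letter_seq, mkseq y n = mkseq s n -> U y.
Proof.
pose G : set_system letter_seq :=
  [set V | exists n, forall y : letter_seq, mkseq y n = mkseq s n -> V y].
have FG : Filter G.
  constructor; first by exists 0.
  - move=> A B [m mA] [n nB]; exists (maxn m n) => y yE.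
    have E k : k <= maxn m n -> mkseq y k = mkseq s k.
      by move=> le; have := congr1 (take k) yE; rewrite !take_mkseq.
    by split; [apply: mA | apply: nB]; apply: E; rewrite ?leq_maxl ?leq_maxr.
  - by move=> A B AB [n nA]; exists n => y /nA/AB.
suff : G --> s by apply.
apply/cvg_sup => i U' /=; case=> B [[C oC <-] Cs BU].
exists i.+1 => y yE; apply: BU; rewrite /=.
have := congr1 (last eL) yE; rewrite !mkseqS !last_rcons => E.
by rewrite /preimage /= /proj E.
Qed.
Lemma cylinder_open x n : open [set y : Omega | prefix y n = prefix x n].
Proof.
elim: n => [|n IH].
  by rewrite (_ : [set _ | _] = setT); [exact: openT | apply/seteqP; split].
have -> : [set y : Omega | prefix y n.+1 = prefix x n.+1] =
  [set y | prefix y n = prefix x n] `&` [set y | letters y n = letters x n].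
  by apply/seteqP; split=> y /=; rewrite !prefixS;
    [move=> /rcons_inj[] | case=> -> ->].
apply: openI => //.
pose pn (y : Omega) : discrete_topology letter := proj n (set_val y : letter_seq).
have -> : [set y | letters y n = letters x n] = pn @^-1` [set letters x n] by [].
apply: open_comp; last exact: discrete_open.
move=> y _; apply: (@continuous_comp Omega letter_seq).
  exact: initial_continuous.
exact: proj_continuous.
Qed.

Lemma nbhs_cylinder (x : Omega) (U : set Omega) : nbhs x U ->
  exists n, [set y | prefix y n = prefix x n] `<=` U.
Proof.
case=> B [[C oC <-] Cx CU].
have [n nC] := nbhs_letter_seq (open_nbhs_nbhs (conj oC Cx)).
by exists n => y yE; apply: CU; apply: nC.
Qed.
(** * Canonical homeomorphisms and rays *)

Lemma canonical_cat f e e' t :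
  canonical_on f e e' -> canonical_on f (e ++ t) (e' ++ t).
Proof.
move=> fe x y ex ey xy; have [//|ex' ey' xy'] := (@same_tail_cat e e' t x y ex).2.
exact: fe.
Qed.

Lemma canonical_comp f g e e' e'' : edge e -> edge e' -> is_red e' = is_red e ->
  canonical_on f e e' -> canonical_on g e' e'' -> canonical_on (g \o f) e e''.
Proof.
move=> ee ee' col fe ge x z ex ez xz.
have [y [_ ey xy]] := graft_exists ee ee' col ex.
by rewrite /= (fe x y) //; apply: ge => // n; rewrite -xy.
Qed.

Lemma canonical_inverse (f : homeo airplane) e e' :
  canonical_on f e e' -> canonical_on (f^-1)%g e' e.
Proof. by move=> fe x y ex ey xy; rewrite -(fe y x) //= ?homeo_funK. Qed.

Lemma extreme_letters rho x n : extreme rho x -> letters x (size rho + n) = bp.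
Proof.
by move=> xr; have := xr n.+1; rewrite addnS prefixS rayS => /rcons_inj[].
Qed.

Lemma extreme_same_tail rho rho' x y : extreme rho x -> extreme rho' y ->
  same_tail rho rho' x y.
Proof.
move=> xr yr; have := extreme_starts 0 xr; have := extreme_starts 0 yr.
by rewrite !ray0 => sy sx; split=> // n; rewrite !extreme_letters.
Qed.

Lemma extreme_point_inj rho rho' x y : radial rho -> radial rho' ->
  extreme rho x -> extreme rho' y -> point_of x = point_of y -> rho = rho'.
Proof.
move=> rr rr' xr yr /point_eqP/(extreme_equivalent rr xr) E.
by apply: (extreme_inj (x := x)) => //; rewrite -E.
Qed.

Lemma canonical_radial_inj f rho rho1 rho2 :
  radial rho -> radial rho1 -> radial rho2 ->
  canonical_on f rho rho1 -> canonical_on f rho rho2 -> rho1 = rho2.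
Proof.
move=> rr rr1 rr2 f1 f2; have [x xr] := extreme_exists rr.
have [y yr] := extreme_exists rr1; have [z zr] := extreme_exists rr2.
apply: (extreme_point_inj rr1 rr2 yr zr).
have [ex ey xy] := extreme_same_tail xr yr.
have [_ ez xz] := extreme_same_tail xr zr.
by rewrite -(f1 x y) // -(f2 x z).
Qed.

(** The radial edge growing on the first circle of a truncated ray is carried
    to the one at the same place of the image, and a radial edge is recovered
    from its tip; so the map determines the target ray and the shift. *)
Lemma canonical_ray_inj f rho k1 k2 rho1 j1 rho2 j2 :
  radial rho -> radial rho1 -> radial rho2 ->
  canonical_on f (ray rho k1) (ray rho1 j1) ->
  canonical_on f (ray rho k2) (ray rho2 j2) ->
  rho1 = rho2 /\ k2 + j1 = k1 + j2.
Proof.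
move=> rr rr1 rr2 /(canonical_cat (t := nseq k2 bp)) f1.
move=> /(canonical_cat (t := nseq k1 bp)) f2; rewrite !rayD in f1 f2.
have {}f1 := canonical_cat (t := [:: up; sr]) f1.
have {}f2 := canonical_cat (t := [:: up; sr]) f2.
have rad r k : radial r -> radial (ray r k ++ [:: up; sr]).
  move=> rad_r; have er := ray_edge k rad_r.
  rewrite /radial last_cat andbT edge_cat ?er /=; last exact: edge_neq0.
  by rewrite andbT /child /replacement -/(is_red (ray r k)) ray_blue.
rewrite [k2 + k1]addnC in f2.
have := canonical_radial_inj (rad _ _ rr) (rad _ _ rr1) (rad _ _ rr2) f1 f2.
rewrite -!cat_rcons !cats0.
move=> /rcons_inj[/rcons_inj[/(ray_inj rr1 rr2)[-> E]]]; split=> //.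
by rewrite addnC E addnC.
Qed.
(** * Realizing graph pair diagrams *)

Definition expansion_iso (d : diagram) : Prop :=
  [/\ expansion (dom d), expansion (cod d) & isomorphism d].

(** The words on which a homeomorphism with diagram [d] acts by replacing a
    prefix: the edges whose direction is kept, and the children of the others,
    since a reversed blue edge permutes its children. *)
Inductive piece (d : diagram) : word -> word -> Prop :=
| piece_edge e : e \in dom d -> preserves_direction d e -> piece d e (emap d e)
| piece_child e c : e \in dom d -> ~~ is_red e -> reverses_direction d e ->
    child (last eL e) c -> piece d (rcons e c) (rcons (emap d e) (flip c)).

Lemma diagram_piece f d g g' :
  graph_pair_diagram f d -> piece d g g' -> canonical_on f g g'.
Proof.
case=> _ _ _ fd []; first by move=> e eD pe; have [+ _] := fd e eD; apply.
by move=> e c eD _ re ec; have [_ /(_ re)] := fd e eD; apply.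
Qed.

Section Pieces.
Variable d : diagram.
Hypothesis d_iso : expansion_iso d.

Let domX : expansion (dom d) := let: And3 h _ _ := d_iso in h.
Let codX : expansion (cod d) := let: And3 _ h _ := d_iso in h.

Lemma emap_cod e : e \in dom d -> emap d e \in cod d.
Proof. by case: d_iso => _ _ [[+ _ _] _ _]; apply. Qed.

Lemma emap_edge e : e \in dom d -> edge (emap d e).
Proof. by move=> /emap_cod/(expansion_edge codX). Qed.

Lemma emap_red e : e \in dom d -> is_red (emap d e) = is_red e.
Proof. by case: d_iso => _ _ [_ _ +] eD => /(_ e eD)[]. Qed.

Lemma vmap_inj : set_inj (vertices (dom d)) (vmap d).
Proof. by case: d_iso => _ _ [_ [_ + _] _]. Qed.

Lemma emap_inj : {in dom d &, injective (emap d)}.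
Proof.
case: d_iso => _ _ [[_ inj _] _ _] e e' eD e'D.
by have memD := @mem_set _ [set` dom d]; exact: (inj e e' (memD _ eD) (memD _ e'D)).
Qed.

Lemma direction_exclusive e : e \in dom d ->
  preserves_direction d e -> reverses_direction d e -> False.
Proof.
move=> eD [pe _] [re _]; apply: (edge_noloop (expansion_edge domX eD)).
have sV : vertices (dom d) (source e) by exists e => //; left.
have tV : vertices (dom d) (target e) by exists e => //; right.
exact: vmap_inj (mem_set sV) (mem_set tV) (etrans (esym pe) re).
Qed.

Lemma piece_types g g' : piece d g g' ->
  [/\ edge g, edge g' & is_red g' = is_red g].
Proof.
case=> [e eD _|e c eD er re cc].
  by split; [exact: expansion_edge eD | exact: emap_edge | exact: emap_red].
have ee := expansion_edge domX eD; have ee' := emap_edge eD.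
rewrite !edge_rcons ?ee ?ee' ?is_red_rcons ?red_flip; try exact: edge_neq0.
split=> //=; rewrite child_flip (@child_red (last eL e)) //.
exact: emap_red.
Qed.

Lemma piece_cover x : exists g g', piece d g g' /\ starts_with g x.
Proof.
have [n nD] := expansion_cover x domX.
case: d_iso => _ _ [_ _ /(_ _ nD)[_ [pe|[er re]]]].
  by do 2!eexists; split; [exact: piece_edge nD pe | exact: starts_with_prefix].
case: n => [|n] in nD er re *; first by have := expansion_edge domX nD.
have cc : child (last eL (prefix x n.+1)) (letters x n.+1).
  have := edge_prefix x n.+1; rewrite (prefixS x n.+1) edge_rcons => [/andP[]//|].
  exact/edge_neq0/edge_prefix.
do 2!eexists; split; first exact: piece_child nD er re cc.
by rewrite -prefixS; exact: starts_with_prefix.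
Qed.

Lemma piece_unique g g' h h' x : piece d g g' -> piece d h h' ->
  starts_with g x -> starts_with h x -> g = h /\ g' = h'.
Proof.
have same e e' : e \in dom d -> e' \in dom d -> starts_with e x ->
    starts_with e' x -> e = e'.
  move=> eD e'D ex e'x; rewrite -ex in eD *; rewrite -e'x in e'D *.
  by congr prefix; exact: expansion_unique domX eD e'D.
have par e c : starts_with (rcons e c) x -> starts_with e x.
  by rewrite -cats1; exact: starts_with_cat.
case=> [e eD pe|e c eD er re cc];
  case=> [e' e'D pe'|e' c' e'D er' re' cc'] ex ex'.
- by have <- := same e e' eD e'D ex ex'.
- have E := same e e' eD e'D ex (par _ _ ex'); rewrite -E in re'.
  by case: (direction_exclusive eD pe re').
- have E := same e e' eD e'D (par _ _ ex) ex'; rewrite -E in pe'.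
  by case: (direction_exclusive eD pe' re).
have E := same e e' eD e'D (par _ _ ex) (par _ _ ex'); subst e'.
move: ex ex'; rewrite /starts_with !size_rcons => -> /rcons_inj[].
by move=> <-.
Qed.

(** The vertex map of the diagram in which every edge of reversed direction has
    been expanded, so that all edges keep their direction. *)
Definition piece_vmap (v : vertex) : vertex :=
  match v with
  | New e nx => if `[< e \in dom d /\ reverses_direction d e >]
                then New (emap d e) ny else vmap d v
  | New e ny => if `[< e \in dom d /\ reverses_direction d e >]
                then New (emap d e) nx else vmap d v
  | _ => vmap d v
  end.

Lemma piece_vmap_old e v : e \in dom d -> incident v e ->
  piece_vmap v = vmap d v.
Proof.
move=> eD ve; case: v ve => // w k wk.
suff wD : w \notin dom d.
  by case: k {wk} => //=; case: asboolP => // -[]; rewrite (negPf wD).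
apply/negP => wD; have [c [t E]] := new_prefix wk.
by rewrite E in eD; have := expansion_antichain domX wD eD.
Qed.

Lemma piece_vmap_new e : e \in dom d -> reverses_direction d e ->
  piece_vmap (New e nx) = New (emap d e) ny /\
  piece_vmap (New e ny) = New (emap d e) nx.
Proof. by move=> eD re; rewrite /=; case: asboolP => // -[]. Qed.

Lemma piece_ends g g' : piece d g g' ->
  source g' = piece_vmap (source g) /\ target g' = piece_vmap (target g).
Proof.
have old e : e \in dom d -> piece_vmap (source e) = vmap d (source e) /\
    piece_vmap (target e) = vmap d (target e).
  by move=> eD; split; apply: (piece_vmap_old eD); [left | right].
case=> [e eD [-> ->]|e c eD er re]; first by have [-> ->] := old e eD.
have [Wx Wy] := piece_vmap_new eD re.
have [Ws Wt] := old e eD; have [rs rt] := re.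
rewrite /child /replacement -/(is_red e) (negPf er) !inE.
by case/or4P=> /eqP-> /=; rewrite !endsE /= ?Wx ?Wy ?Ws ?Wt ?rs ?rt.
Qed.

(** The vertex map of the canonical map between two pieces, at all depths. *)
Definition deep_vmap (g g' : word) (v : vertex) : vertex :=
  if v is New w k then
    if seq.prefix g w then New (g' ++ drop (size g) w) k else piece_vmap v
  else piece_vmap v.

Lemma deep_vmap_old g g' v : incident v g -> deep_vmap g g' v = piece_vmap v.
Proof.
case: v => // w k /size_new lt; rewrite /deep_vmap.
case: seq.prefixP => // -[s sE]; move: lt.
by rewrite sE size_cat ltnNge leq_addr.
Qed.

Lemma deep_ends g g' t : piece d g g' -> all (predC base) t ->
  source (g' ++ t) = deep_vmap g g' (source (g ++ t)) /\
  target (g' ++ t) = deep_vmap g g' (target (g ++ t)).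
Proof.
move=> gg'; elim/last_ind: t => [|t c IH].
  rewrite !cats0; have [-> ->] := piece_ends gg' => _.
  by rewrite !deep_vmap_old //; [right | left].
rewrite all_rcons => /andP[/= cN /IH{IH}[IHs IHt]].
have new k : New (g' ++ t) k = deep_vmap g g' (New (g ++ t) k).
  by rewrite /deep_vmap prefix_prefix drop_size_cat.
rewrite -!rcons_cat !endsE; case: c cN => //= _; by rewrite ?IHs ?IHt ?new.
Qed.

Definition image (x y : Omega) : Prop :=
  exists g g', piece d g g' /\ same_tail g g' x y.

Lemma image_exists x : exists y, image x y.
Proof.
have [g [g' [gg' gx]]] := piece_cover x; have [eg eg' col] := piece_types gg'.
by have [y xy] := graft_exists eg eg' col gx; exists y, g, g'.
Qed.

Lemma image_onto y : exists x, image x y.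
Proof.
have [n nC] := expansion_cover y codX.
case: d_iso => _ _ [[_ _ /(_ _ nC)[e eD eE]] _ /(_ e eD)[_ [pe|[er re]]]].
  have gg' := piece_edge eD pe; have [eg eg' col] := piece_types gg'.
  have ey : starts_with (emap d e) y by rewrite eE; exact: starts_with_prefix.
  have [x yx] := graft_exists eg' eg (esym col) ey.
  by exists x, e, (emap d e); split=> //; exact: same_tail_sym.
set c := letters y n.
have cy : starts_with (rcons (emap d e) c) y.
  by rewrite eE -prefixS; exact: starts_with_prefix.
have cc : child (last eL e) (flip c).
  have ee' := emap_edge eD.
  have := starts_with_edge _ cy; rewrite edge_rcons; last exact: edge_neq0.
  rewrite child_flip ee' (@child_red (last eL e)); last exact: emap_red.
  by apply; case: (emap d e) ee'.
have := piece_child eD er re cc; rewrite flipK => gg'.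
have [eg eg' col] := piece_types gg'.
have [x yx] := graft_exists eg' eg (esym col) cy.
exists x, (rcons e (flip c)), (rcons (emap d e) c); split=> //.
exact: same_tail_sym.
Qed.

(** If the prefixes of [x] keep meeting the vertex [v], those of its image keep
    meeting the image of [v]; the bound only has to pass the length of the
    piece. *)
Lemma image_incident g g' x y v N : piece d g g' -> same_tail g g' x y ->
  (forall n, N <= n -> incident v (prefix x n)) ->
  forall n, size g' + N <= n -> incident (deep_vmap g g' v) (prefix y n).
Proof.
move=> gg' xy vx n le; have [eg _ _] := piece_types gg'.
have le' : size g' <= n by apply: leq_trans le; exact: leq_addr.
rewrite -(subnKC le'); set m := n - size g'.
have [xE yE] := same_tail_prefix m xy; rewrite yE.
have : incident v (prefix x (size g + m)).
  by apply: vx; apply: leq_trans (leq_addl _ _); rewrite leq_subRL.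
have tN : all (predC base) (tail (size g) x m).
  apply/allP => c /mapP[i _ ->] /=; case: (g) eg => // c0 g0 _.
  exact: letters_nbase.
have [sE tE] := deep_ends gg' tN.
by rewrite xE /incident sE tE => -[->|->]; [left | right].
Qed.

(** The action on names is compatible with the gluing. Different names of a
    point are names of a vertex; if they lie in one piece, the same prefix is
    replaced in both, and if they lie in two pieces, the vertex is a common
    endpoint of these, where the vertex map of the isomorphism applies to
    both. *)
Lemma image_equivalent x x' y y' : image x y -> image x' y' ->
  equivalent x x' -> equivalent y y'.
Proof.
move=> [g [g' [gg' xy]]] [h [h' [hh' xy']]] xx'.
have [gx _ _] := xy; have [hx' _ _] := xy'.
have [E|neq] := pselect (x = x').
  subst x'; have [E E'] := piece_unique gg' hh' gx hx'; subst h h'.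
  by rewrite (same_tail_fun xy xy'); exact: equivalent_refl.
have [eg _ _] := piece_types gg'; have [eh _ _] := piece_types hh'.
have g0 : 0 < size g by case: (g) eg.
have h0 : 0 < size h by case: (h) eh.
have [v [N vxx' vE]] : exists v, exists2 N,
    forall n, N <= n -> incident v (prefix x n) /\ incident v (prefix x' n)
    & deep_vmap g g' v = deep_vmap h h' v.
  have [E|gh] := pselect (g = h).
    subst h; have [_ <-] := piece_unique gg' hh' hx' hx'.
    have [n nP] : exists n, prefix x n <> prefix x' n.
      by apply/existsNP => xE; apply: neq; apply: prefix_inj.
    have n0 : 0 < n by case: n nP.
    by have [v vP] := shared_vertex n0 nP xx'; exists v, n.
  (* At this depth one of the words is a whole piece, and the other name has
     left that piece; so the common vertex is an endpoint of both pieces. *)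
  pose N := minn (size g) (size h).
  have N0 : 0 < N by rewrite leq_min g0.
  have NP : prefix x N <> prefix x' N.
    rewrite /N => E; apply: gh; have [le|/ltnW le] := leqP (size g) (size h).
      move: E; rewrite (minn_idPl le) gx => E.
      by have [] := piece_unique gg' hh' (esym E) hx'.
    move: E; rewrite (minn_idPr le) hx' => E.
    by have [] := piece_unique gg' hh' gx E.
  have [v vP] := shared_vertex N0 NP xx'; exists v, N => //.
  have [vg _] := vP _ (geq_minl _ _); have [_ vh] := vP _ (geq_minr _ _).
  by rewrite gx in vg; rewrite hx' in vh; rewrite !deep_vmap_old.
apply: (@eventually_adjacent _ _ (maxn (size g' + N) (size h' + N))) => n.
rewrite geq_max => /andP[le le']; exists (deep_vmap g g' v).
  by apply: image_incident gg' xy _ _ le => m /vxx'[].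
by rewrite vE; apply: image_incident hh' xy' _ _ le' => m /vxx'[].
Qed.

End Pieces.

(** A diagram read from right to left represents the inverse. *)
Lemma inverse_diagram d : expansion_iso d -> exists2 d',
  expansion_iso d' & forall g g', piece d g g' <-> piece d' g' g.
Proof.
move=> di; have [domX codX [[ef _ esurj] [vf _ vsurj] edir]] := di.
have /choice[ei eiP] e : exists e', e \in cod d -> e' \in dom d /\ emap d e' = e.
  by case E: (e \in cod d); [have [e' ? <-] := esurj e E; exists e' | exists e].
have /choice[vi viP] v : exists v', vertices (cod d) v ->
    vertices (dom d) v' /\ vmap d v' = v.
  have [/vsurj[v' ? <-]|] := pselect (vertices (cod d) v); last by exists v.
  by exists v'.
have eK e : e \in dom d -> ei (emap d e) = e.
  move=> eD; have [iD iE] := eiP _ (emap_cod di eD).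
  exact: (emap_inj di iD eD).
have vK v : vertices (dom d) v -> vi (vmap d v) = v.
  move=> vD; have [iD iE] := viP _ (vf _ vD).
  exact: (vmap_inj di (mem_set iD) (mem_set vD)).
have vKs e : e \in dom d -> vi (vmap d (source e)) = source e.
  by move=> eD; apply: vK; exists e => //; left.
have vKt e : e \in dom d -> vi (vmap d (target e)) = target e.
  by move=> eD; apply: vK; exists e => //; right.
pose d' := Diagram (cod d) (dom d) ei vi.
have pres e : e \in dom d -> preserves_direction d e ->
    preserves_direction d' (emap d e).
  by move=> eD [s t]; rewrite /preserves_direction /= eK // s t vKs ?vKt.
have rev e : e \in dom d -> reverses_direction d e ->
    reverses_direction d' (emap d e).
  by move=> eD [s t]; rewrite /reverses_direction /= eK // s t vKs ?vKt.
have di' : expansion_iso d'.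
  split=> //; split=> [||e eC] /=.
  - split=> [e eC|e e' /set_mem eC /set_mem eC' E|e eD].
    + by have [] := eiP _ eC.
    + by have [_ <-] := eiP _ eC; have [_ <-] := eiP _ eC'; rewrite E.
    + by exists (emap d e); [exact: (emap_cod di) | exact: eK].
  - split=> [v vC|v v' /set_mem vC /set_mem vC' E|v vD].
    + by have [] := viP _ vC.
    + by have [_ <-] := viP _ vC; have [_ <-] := viP _ vC'; rewrite E.
    + by exists (vmap d v); [exact: vf | exact: vK].
  - have [iD iE] := eiP _ eC; have [col dir] := edir _ iD.
    have := pres _ iD; have := rev _ iD; rewrite iE in col *.
    rewrite col => revi presi; split=> //.
    by case: dir => [/presi|[er /revi]]; [left | right].
exists d' => // g g'; split=> [[e eD pe|e c eD er re ec]|].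
- rewrite -{2}(eK e eD); apply: piece_edge; last exact: pres.
  exact: (emap_cod di).
- rewrite -{2}(flipK c) -{2}(eK e eD); apply: piece_child.
  + exact: (emap_cod di).
  + by rewrite (emap_red di).
  + exact: rev.
  + rewrite child_flip (@child_red (last eL e)) //; exact: (emap_red di).
case=> [e eC pe|e c eC er re ec] /=;
  have [iD iE] := eiP _ eC; have [_ dir] := edir _ iD.
- case: dir => [pi|[_ /(rev _ iD)]]; first by rewrite -{2}iE; exact: piece_edge.
  by rewrite iE => /(direction_exclusive di' eC pe).
case: dir => [/(pres _ iD)|[ei_blue ri]].
  by rewrite iE => pi; case: (direction_exclusive di' eC pi re).
rewrite -{2}(flipK c) -{2}iE; apply: piece_child => //.
rewrite child_flip -(@child_red (last eL (ei e)) (last eL e)) //.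
by rewrite -/(is_red e) -/(is_red (ei e)) -{1}iE (emap_red di).
Qed.

Lemma piece_diagram (f : homeo airplane) d : expansion_iso d ->
  (forall g g', piece d g g' -> canonical_on f g g') -> graph_pair_diagram f d.
Proof.
move=> di can; have [domX codX iso] := di; split=> // e eD.
split=> [pe|re c cc]; apply: can; first exact: piece_edge.
have [_ _ /(_ e eD)[_ [pe|[er _]]]] := iso; last exact: piece_child.
by case: (direction_exclusive di eD pe re).
Qed.

Lemma inverse_graph_pair (f : homeo airplane) d : graph_pair_diagram f d ->
  exists d', graph_pair_diagram (f^-1)%g d'.
Proof.
move=> fd; have [|d' di' inv] := @inverse_diagram d; first by case: fd.
exists d'; apply: piece_diagram => // g g' /inv gg'.
exact/canonical_inverse/(diagram_piece fd).
Qed.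

(** A prefix replacement is continuous: the piece is fixed on a cylinder, and
    letters are only moved by a constant amount. *)
Lemma image_continuous d (F : Omega -> Omega) : expansion_iso d ->
  (forall x, image d x (F x)) -> continuous F.
Proof.
move=> di Fi x U /nbhs_cylinder[n nU].
have [g [g' [gg' xy]]] := Fi x; have [gx g'y _] := xy.
change (nbhs x (F @^-1` U)).
apply: (@filterS _ _ _ [set z | prefix z (size g + n) = prefix x (size g + n)]);
  last first.
  apply: open_nbhs_nbhs; split=> //; exact: cylinder_open.
move=> z /= zx; apply: nU => /=.
have [h [h' [hh' xy']]] := Fi z; have [hz _ _] := xy'.
have gz : starts_with g z.
  rewrite /starts_with -(take_prefix z (leq_addr n (size g))) zx.
  by rewrite take_prefix ?leq_addr.
have [E E'] := piece_unique di gg' hh' gz hz; subst h h'.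
have [xE yE] := same_tail_prefix n xy; have [zE wE] := same_tail_prefix n xy'.
have tE : tail (size g) x n = tail (size g) z n.
  by move: zx; rewrite xE zE => /eqP; rewrite eqseq_cat // eqxx => /eqP.
rewrite -(take_prefix _ (leq_addl (size g') n)) wE -tE -yE.
by rewrite take_prefix ?leq_addl.
Qed.

(** An isomorphism between expansions acts on names, this action descends to the
    quotient by [image_equivalent], and the inverse diagram provides the inverse
    homeomorphism. *)
Lemma diagram_realization d : expansion_iso d ->
  exists f : homeo airplane, graph_pair_diagram f d.
Proof.
move=> di; have [d' di' inv] := inverse_diagram di.
have [F Fi] := choice (image_exists di).
have [G Gi] := choice (image_exists di').
pose f (p : airplane) : airplane := point_of (F (repr p)).
pose g (p : airplane) : airplane := point_of (G (repr p)).
have reprE x : equivalent (repr (point_of x)) x.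
  by apply/point_eqP; exact: reprK.
have fE x y : image d x y -> f (point_of x) = point_of y.
  move=> xy; apply/point_eqP;
  exact: image_equivalent di _ _ _ _ (Fi _) xy (reprE x).
have gE x y : image d' x y -> g (point_of x) = point_of y.
  move=> xy; apply/point_eqP;
  exact: image_equivalent di' _ _ _ _ (Gi _) xy (reprE x).
have image_inv x y : image d x y -> image d' y x.
  by case=> h [h' [/inv hh' /same_tail_sym xy]]; exists h', h.
have pointP p : exists x, p = point_of x.
  by exists (repr p); rewrite /point_of reprK.
have fK : cancel f g.
  move=> p; have [x ->] := pointP p.
  by rewrite (fE _ _ (Fi x)) (gE _ x) //; apply: image_inv.
have gK : cancel g f.
  move=> p; have [y ->] := pointP p.
  have [x xy] := image_onto di y.
  by rewrite (gE _ x) ?(fE _ y) //; apply: image_inv.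
have fc : continuous f.
  apply/quotient_continuous.
  have -> : f \o \pi_airplane = point_of \o F.
    by apply/funext => x /=; exact: fE.
  move=> x; apply: continuous_comp; first exact: image_continuous di Fi _.
  exact: pi_continuous.
have gc : continuous g.
  apply/quotient_continuous.
  have -> : g \o \pi_airplane = point_of \o G.
    by apply/funext => x /=; exact: gE.
  move=> x; apply: continuous_comp; first exact: image_continuous di' Gi _.
  exact: pi_continuous.
exists (Homeo fK gK fc gc); apply: piece_diagram => // h h' hh' x y hx hy xy.
by apply: fE; exists h, h'.
Qed.
(** * Rearrangements and extremal derivatives *)

Lemma cell_extreme e x rho : radial rho -> extreme rho x ->
  cell e (point_of x) -> starts_with e x.
Proof.
move=> rr xr [y ey /esym/point_eqP/(extreme_equivalent rr xr) E].
by rewrite -E.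
Qed.

(** Cells whose interiors meet both contain some external extreme of the common
    open set, and its only name begins with both words. *)
Lemma cell_interior e e' : ((cell e)° `&` (cell e')°) !=set0 ->
  exists x, starts_with e x /\ starts_with e' x.
Proof.
move=> [p [pe pe']].
have nU : nbhs p (cell e `&` cell e') by apply: filterI.
pose x : Omega := repr p; have xp : \pi_airplane x = p by exact: reprK.
have : nbhs x (\pi_airplane @^-1` (cell e `&` cell e')).
  by apply: (pi_continuous (Q0 := airplane_quot)); rewrite [X in nbhs X]xp.
case/nbhs_cylinder=> n nV.
have [rho [y [rr yr xy]]] := edge_extreme (edge_prefix x n).
have [|ye ye'] := nV y.
  by move: xy; rewrite /starts_with size_prefix /= => /(congr1 (take n));
     rewrite !take_prefix.
by exists y; split; exact: cell_extreme rr yr _.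
Qed.

Definition pieces (d : diagram) : {fset word} :=
  [fset g in flatten [seq if `[< preserves_direction d e >] then [:: e]
                          else [seq rcons e c | c <- replacement (last eL e)]
                     | e <- dom d]]%fset.

Lemma piecesP d g : expansion_iso d ->
  g \in pieces d <-> exists g', piece d g g'.
Proof.
move=> di; rewrite /pieces inE /=; split.
  case/flatten_mapP=> e eD; case: asboolP => [pe|npe].
    by rewrite inE => /eqP->; exists (emap d e); exact: piece_edge.
  case/mapP=> c cc ->; exists (rcons (emap d e) (flip c)).
  by case: di => _ _ [_ _ /(_ e eD)[_ [//|[er re]]]]; exact: piece_child.
case=> g' [e eD pe|e c eD er re cc]; apply/flatten_mapP; exists e => //.
  by case: asboolP => // _; rewrite inE.
by case: asboolP => [/(direction_exclusive di eD)/(_ re)//|_]; exact: map_f.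
Qed.

(** The pieces form a cellular partition: every word begins with exactly one of
    them. *)
Lemma diagram_T_A f d : graph_pair_diagram f d -> T_A f.
Proof.
move=> fd; have di : expansion_iso d by case: fd.
exists (pieces d); last first.
  move=> g /(piecesP _ di)[g' gg']; exists g'.
  have [_ eg' col] := piece_types di gg'.
  by split=> //; exact: diagram_piece fd gg'.
split.
- by move=> g /(piecesP _ di)[g' /(piece_types di)[]].
- apply/seteqP; split=> // p _.
  have [g [g' [gg' gx]]] := piece_cover di (repr p).
  exists g; first by apply/(piecesP _ di); exists g'.
  by exists (repr p) => //; exact: reprK.
- move=> g h /(piecesP _ di)[g' gg'] /(piecesP _ di)[h' hh'].
  case/cell_interior=> x [gx hx].
  by have [] := piece_unique di gg' hh' gx hx.
Qed.

(** Reducing strictly decreases the number of edges, so it terminates. *)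
Lemma reduced_exists f d : graph_pair_diagram f d ->
  exists d', reduced_diagram f d'.
Proof.
have [n] := ubnP #|` dom d|; elim: n d => // n IH d le fd.
have [[d0 [e [fd0 eD [dE _ _ _ _]]]]|irr] :=
    pselect (exists d0 e, [/\ graph_pair_diagram f d0, e \in dom d0
                            & diagram_expansion d0 e d]); last by exists d.
apply: (IH d0) => //; have [X0 _ _ _] := fd0.
by rewrite -ltnS; apply: leq_trans le; rewrite dE ltnS card_replace_edge.
Qed.

Lemma extreme_vertex rho x v N : radial rho -> extreme rho x ->
  (forall n, N <= n -> incident v (prefix x n)) -> v = target rho.
Proof.
move=> rr xr vx.
have := vx (size rho + N) (leq_addl _ _); rewrite xr => v1.
have := vx (size rho + N.+1) (leq_trans (leqnSn _) (leq_addl _ _)).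
rewrite xr rayS /incident !endsE /= target_ray => -[vE|//].
by case: (@new_notin (ray rho N) ny); rewrite -vE.
Qed.

Lemma external_extreme_name p : external_extremes p <->
  exists rho x, [/\ radial rho, extreme rho x & p = point_of x].
Proof.
split=> [[rho rr [x <- [N xN]]]|[rho [x [rr xr ->]]]].
  exists rho, x; split=> // n.
  have := xN (size rho + N + n).+1.
  rewrite (leq_trans (leq_addl (size rho) N)); last first.
    by rewrite -addnS leq_addr.
  move=> /(_ isT)/(incident_extreme rr (edge_prefix _ _))[k xE].
  have le : size rho + n <= (size rho + N + n).+1.
    by rewrite ltnW // ltnS leq_add2r leq_addr.
  rewrite -(take_prefix x le) xE /ray take_cat ltnNge leq_addr /= addKn.
  congr cat; have := congr1 size xE; rewrite size_prefix size_ray => kE.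
  have nk : n <= k by rewrite -(leq_add2l (size rho)) -kE.
  by rewrite -{1}(subnKC nk) nseqD take_size_cat ?size_nseq.
exists rho => //; exists x => //; exists (size rho) => n le.
by rewrite -(subnKC le) xr; right; rewrite target_ray.
Qed.

Lemma endpoint_extreme rho x e : radial rho -> extreme rho x -> edge e ->
  endpoint (point_of x) e -> exists k, e = ray rho k.
Proof.
move=> rr xr ee [v ve [y yx [N yN]]]; apply: incident_extreme => //.
move/esym/point_eqP: yx => /(extreme_equivalent rr xr) E; subst y.
by rewrite -(extreme_vertex rr xr yN).
Qed.

Lemma endpoint_ray rho x k : extreme rho x -> endpoint (point_of x) (ray rho k).
Proof.
move=> xr; exists (target rho); first by right; rewrite target_ray.
exists x => //; exists (size rho) => n le.
by rewrite -(subnKC le) xr; right; rewrite target_ray.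
Qed.

Lemma edge_length_ray rho k : radial rho ->
  edge_length (ray rho k) = (2%:R^-1 ^+ k)%R.
Proof.
case/andP; case/lastP: rho => // r c _; rewrite last_rcons => cR.
rewrite /edge_length /ray rev_cat rev_rcons find_cat rev_nseq.
have -> : has (fun c => c \notin [:: bm; bp]) (nseq k bp) = false.
  by elim: k.
by rewrite size_nseq /=; case: c cR => //= _; rewrite addn0.
Qed.

Lemma radial_graft g g' t : edge g -> edge g' -> is_red g' = is_red g ->
  t <> [::] -> radial (g ++ t) -> radial (g' ++ t).
Proof.
move=> eg eg' col t0; rewrite /radial (edge_graft _ eg eg' col) !last_cat.
by case: t t0.
Qed.

Lemma expansion_ray_inj D rho k j : radial rho -> expansion D ->
  ray rho k \in D -> ray rho j \in D -> k = j.
Proof.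
move=> rr XD kD jD; have [x xr] := extreme_exists rr.
by apply/(@addnI (size rho))/(expansion_unique (x := x) XD); rewrite xr.
Qed.

(** Inside a diagram, an external extreme lies either in the interior of the
    cell of an edge, where nothing happens to its ray, or at the end of an edge
    along its ray. In the second case it is a vertex of degree one, which the
    isomorphism can only send to a vertex of degree one, that is, to another
    external extreme. *)
Lemma diagram_ray f d rho : graph_pair_diagram f d -> radial rho ->
  (exists e t, [/\ e \in dom d, t <> [::], rho = e ++ t
     & exists2 rho', radial rho' & canonical_on f rho rho']) \/
  (exists k rho' j, [/\ ray rho k \in dom d, radial rho',
     emap d (ray rho k) = ray rho' j
     & canonical_on f (ray rho k) (ray rho' j)]).
Proof.
move=> fd rr; have di : expansion_iso d by case: fd.
have [domX codX iso _] := fd.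
have [x xr] := extreme_exists rr.
have [n nD] := expansion_cover x domX.
have [lt|le] := ltnP n (size rho).
  left; set e := prefix x n in nD.
  have rx : starts_with rho x by rewrite -[rho]ray0; exact: extreme_starts.
  have [t rE] : exists t, rho = e ++ t.
    apply: (starts_with_comparable (starts_with_prefix x n) rx).
    by rewrite size_prefix ltnW.
  have t0 : t <> [::].
    by move=> t0; move: lt; rewrite rE t0 cats0 size_prefix ltnn.
  exists e, t; split=> //.
  have whole g g' s : piece d g g' -> rho = g ++ s -> s <> [::] ->
      exists2 rho', radial rho' & canonical_on f rho rho'.
    move=> gg' gE s0; have [eg eg' col] := piece_types di gg'.
    exists (g' ++ s); first by apply: radial_graft eg eg' col s0 _; rewrite -gE.
    by rewrite gE; apply/canonical_cat/(diagram_piece fd).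
  have [_ _ /(_ e nD)[_ [pe|[er re]]]] := iso.
    exact: whole (piece_edge nD pe) rE t0.
  case: t rE t0 => // c t rE _.
  have ee := expansion_edge domX nD.
  have cc : child (last eL e) c.
    have : edge (rcons e c).
      have ec := radial_edge rr; rewrite rE -cat_rcons in ec.
      by apply: edge_catW ec; case: (e).
    by rewrite edge_rcons; [case/andP | exact: edge_neq0].
  apply: (whole _ _ t (piece_child nD er re cc)); first by rewrite cat_rcons.
  move=> t0; case/andP: rr => _; rewrite rE t0 last_cat /=.
  by move: cc; rewrite /child /replacement -/(is_red e) (negPf er); case: (c).
right; have nE : prefix x n = ray rho (n - size rho) by rewrite -xr subnKC.
rewrite nE in nD; move: (n - size rho) nD => k kD {n le nE}.
have eC := emap_cod di kD.
pose v := vmap d (target rho).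
have [_ _ edir] := iso; have [_ dir] := edir _ kD.
have ve : incident v (emap d (ray rho k)).
  rewrite /v -(target_ray rho k).
  by case: dir => [[_ <-]|[_ [<- _]]]; [right | left].
have [[rho' rr' vE]|[e2 [e2C e2ne ve2]]] := expansion_degree codX eC ve.
  rewrite vE in ve; have [j eE] := incident_extreme rr' (emap_edge di kD) ve.
  exists k, rho', j; split=> //; rewrite -eE.
  case: dir => [pe|[_ [re _]]].
    exact: diagram_piece fd (piece_edge kD pe).
  by case: (@source_ray_neq rho' j rr'); rewrite -eE re target_ray -vE.
have [_ _ /(_ _ e2C)[e1 e1D e1E]] : set_bij [set` dom d] [set` cod d] (emap d).
  by case: iso.
have old w : incident w e1 -> v = vmap d w -> e1 = ray rho k.
  move=> we1 vw; have wD : vertices (dom d) w by exists e1.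
  have tD : vertices (dom d) (target rho).
    by exists (ray rho k) => //; right; rewrite target_ray.
  have tw : target rho = w := vmap_inj di (mem_set tD) (mem_set wD) vw.
  rewrite -tw in we1.
  have [j e1j] := incident_extreme rr (expansion_edge domX e1D) we1.
  rewrite e1j in e1D *; congr ray; exact: expansion_ray_inj rr domX e1D kD.
case: e2ne; rewrite -e1E; congr emap; move: ve2; rewrite -e1E.
have [_ [[s t]|[_ [s t]]]] := edir _ e1D; rewrite /incident s t => -[].
- by apply: old; left.
- by apply: old; right.
- by apply: old; right.
- by apply: old; left.
Qed.

Lemma half_exp_inj k j : (2%:R^-1 ^+ k : rat)%R = (2%:R^-1 ^+ j)%R -> k = j.
Proof. exact: Num.Theory.ieexprIn. Qed.

(** On the edge [ray rho k] sent to [ray rho' j] the derivative is 2 ^ (k - j),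
    so a derivative equal to 1 leaves no shift. *)
Lemma derivative_canonical f rho x : radial rho -> extreme rho x ->
  extremal_derivative f (point_of x) 1%R ->
  exists k rho', radial rho' /\ canonical_on f (ray rho k) (ray rho' k).
Proof.
move=> rr xr [d [fd _] D1].
have [[e [t [_ _ _ [rho' rr' fr]]]]|[k [rho' [j [kD rr' kE fk]]]]] :=
  diagram_ray fd rr.
  by exists 0, rho'; rewrite !ray0.
exists k, rho'; split=> //; case: D1 => [[[]]|[e [eD pe q1]]].
  by exists (ray rho k) => //; exact: endpoint_ray.
have [X _ _ _] := fd.
have [i eE] := endpoint_extreme rr xr (expansion_edge X eD) pe.
rewrite eE in eD q1; rewrite (expansion_ray_inj rr X eD kD) kE in q1.
rewrite !edge_length_ray // in q1.
have jk : j = k := half_exp_inj (GRing.divr1_eq (esym q1)).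
by rewrite -{2}jk.
Qed.

(** The derivatives can be read off from the homeomorphism, without looking at
    the reduced diagram: in any diagram the edge at an external extreme yields
    a canonical map of truncated rays, and [canonical_ray_inj] makes its shift
    independent of the diagram. *)
Lemma canonical_in_E f d : graph_pair_diagram f d ->
  (forall rho, radial rho ->
     exists k rho', radial rho' /\ canonical_on f (ray rho k) (ray rho' k)) ->
  E f.
Proof.
move=> fd fray; split; first exact: diagram_T_A fd.
have [d' rd] := reduced_exists fd; have [fd' _] := rd.
have [X _ _ _] := fd'.
move=> p /external_extreme_name[rho [x [rr xr ->]]]; exists d' => //.
have [[e eD pe]|np] :=
  pselect (exists2 e, e \in dom d' & endpoint (point_of x) e); last by left.
right; have [k eE] := endpoint_extreme rr xr (expansion_edge X eD) pe; subst e.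
exists (ray rho k); split=> //.
have [[e [t [e'D t0 rE _]]]|[k' [rho' [j [kD rr' kE fk]]]]] := diagram_ray fd' rr.
  case: t0; have := expansion_antichain X e'D (t := t ++ nseq k bp).
  by rewrite catA -rE => /(_ eD); case: (t).
rewrite (expansion_ray_inj rr X kD eD) in kE fk.
have [i [rho'' [rr'' fi]]] := fray _ rr.
have [_ E] := canonical_ray_inj rr rr' rr'' fk fi.
rewrite kE !edge_length_ray //.
have -> : j = k by move: E; rewrite [k + i]addnC => /addnI.
by rewrite GRing.divff // GRing.expf_neq0 // GRing.invr_eq0.
Qed.
(** * A shift along the inside of a ray *)

(** As expansions have no isolated vertices, a vertex map compatible with a
    surjective edge map is surjective. *)
Lemma isomorphismI d :
  set_bij [set` dom d] [set` cod d] (emap d) ->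
  set_inj (vertices (dom d)) (vmap d) ->
  (forall e, e \in dom d -> is_red (emap d e) = is_red e /\
     (preserves_direction d e \/ ~~ is_red e /\ reverses_direction d e)) ->
  isomorphism d.
Proof.
move=> eb vi edir; have [ef _ es] := eb; split=> //.
split=> // [v [e eD ve]|v [e' e'C ve']].
  exists (emap d e); first exact: ef.
  have [_ [[s t]|[_ [s t]]]] := edir _ eD; case: ve => ->; rewrite -?s -?t;
    by [left | right].
have [e eD eE] := es _ e'C; rewrite -eE in ve'.
have sD : vertices (dom d) (source e) by exists e => //; left.
have tD : vertices (dom d) (target e) by exists e => //; right.
have [_ [[s t]|[_ [s t]]]] := edir _ eD; case: ve'; rewrite ?s ?t => ->;
  by [exists (source e) | exists (target e)].
Qed.

(** The homeomorphism built here is the analogue, on a blue edge [e], of the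
    generator x_0 of Thompson's group F. Expanding [e] and then [rcons e bp]
    cuts the segment from [source e] to [target e] into three blue edges
    separated by two circles, and so does expanding [e] and then [rcons e bm];
    the isomorphism matches the two lists in order. The middle blue edge points
    in opposite directions on the two sides, since [bm] and [bp] both point
    outwards. *)
Definition shift_leaf (t : word) : word :=
  match t with
  | [:: bm] => [:: bm; bp]
  | [:: up] => [:: bm; dn]
  | [:: dn] => [:: bm; up]
  | [:: bp; bm] => [:: bm; bm]
  | [:: bp; up] => [:: up]
  | [:: bp; dn] => [:: dn]
  | [:: bp; bp] => [:: bp]
  | _ => t
  end.

Definition leaves (b : letter) : seq word :=
  [seq [:: c] | c <- [:: bm; bp; up; dn] & c != b] ++
  [seq [:: b; c] | c <- [:: bm; bp; up; dn]].

Definition shift_edge (e g : word) : word :=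
  if seq.prefix e g then e ++ shift_leaf (drop (size e) g) else g.

Definition shift_vertex (e : word) (v : vertex) : vertex :=
  if v is New w k then
    if w == e then
      New (rcons e bm) (match k with nx => ny | ny => nx | _ => k end)
    else if w == rcons e bp then New e k else v
  else v.

Definition shift_diagram (D : {fset word}) (e : word) : diagram :=
  Diagram (replace_edge (replace_edge D e) (rcons e bp))
          (replace_edge (replace_edge D e) (rcons e bm))
          (shift_edge e) (shift_vertex e).

Lemma rcons_neq (w : word) c : rcons w c <> w.
Proof. by move/(congr1 size)/eqP; rewrite size_rcons eqn_leq ltnn. Qed.

Section Shift.
Variables (D : {fset word}) (e : word).
Hypotheses (D_expansion : expansion D) (eD : e \in D) (e_blue : ~~ is_red e).

Lemma child_blue c : child (last eL e) c = (c \in [:: bm; bp; up; dn]).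
Proof. by rewrite /child /replacement -/(is_red e) (negPf e_blue). Qed.

Lemma kept_neq g t : g \in D -> g <> e -> g <> e ++ t.
Proof.
move=> gD ge gE; apply: ge; rewrite gE in gD *.
by rewrite (expansion_antichain D_expansion eD gD) cats0.
Qed.

Lemma double_replaceP b g : b \in [:: bm; bp] ->
  g \in replace_edge (replace_edge D e) (rcons e b) <->
  (g \in D /\ g <> e) \/ exists2 t, t \in leaves b & g = e ++ t.
Proof.
move=> bB; have rb : red b = false by move: bB; rewrite !inE => /orP[] /eqP->.
have leafP t : t \in leaves b <->
    (exists c, [/\ child (last eL e) c, c <> b & t = [:: c]]) \/
    exists2 c, child b c & t = [:: b; c].
  rewrite /leaves mem_cat; split.
    case/orP=> /mapP[c cc ->].
      left; exists c; move: cc.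
      by rewrite mem_filter child_blue => /andP[/eqP cb cc].
    by right; exists c => //; rewrite /child /replacement rb.
  case=> [[c [cc cb ->]]|[c cc ->]]; apply/orP; [left | right]; apply: map_f.
    by rewrite mem_filter -child_blue cc andbT; apply/eqP.
  by move: cc; rewrite /child /replacement rb.
split.
  case/replace_edgeP=> [[/replace_edgeP[[gD ge]|[c cc gE]] gb]|[c cc gE]].
  - by left.
  - right; exists [:: c]; last by rewrite gE cats1.
    by apply/leafP; left; exists c; split=> // cb; apply: gb; rewrite gE cb.
  - right; exists [:: b; c]; last by rewrite gE -cat_rcons cats1.
    by apply/leafP; right; exists c => //; rewrite last_rcons in cc.
case=> [[gD ge]|[t /leafP[[c [cc cb ->]]|[c cc ->]] ->]]; apply/replace_edgeP.
- left; split; first by apply/replace_edgeP; left.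
  by rewrite -cats1; exact: kept_neq.
- left; split; last by rewrite cats1 => /rcons_inj[].
  by apply/replace_edgeP; right; exists c; rewrite ?cats1.
- by right; exists c; rewrite ?last_rcons // -cat_rcons cats1.
Qed.

Lemma shift_edge_kept g : g \in D -> g <> e -> shift_edge e g = g.
Proof.
move=> gD ge; rewrite /shift_edge; case: seq.prefixP => // -[t gE].
by case: (kept_neq (t := t) gD ge).
Qed.

Lemma shift_edge_leaf t : shift_edge e (e ++ t) = e ++ shift_leaf t.
Proof. by rewrite /shift_edge prefix_prefix drop_size_cat. Qed.

Lemma shift_vertex_kept g v : g \in D -> g <> e -> incident v g ->
  shift_vertex e v = v.
Proof.
move=> gD ge; case: v => // w k /new_prefix[c [t gE]] /=.
case: eqP => [we|_]; first by case: (kept_neq (t := c :: t) gD ge); rewrite -we.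
case: eqP => // we; case: (kept_neq (t := bp :: c :: t) gD ge).
by rewrite -cat_rcons -we.
Qed.

Lemma shift_vertex_end v : incident v e -> shift_vertex e v = v.
Proof.
case: v => // w k /size_new /= lt.
case: eqP => [we|_]; first by rewrite we ltnn in lt.
by case: eqP => // we; rewrite we size_rcons ltnNge leqnSn in lt.
Qed.

Lemma shift_leaf_direction t : t \in leaves bp ->
  is_red (e ++ shift_leaf t) = is_red (e ++ t) /\
  (preserves_direction (shift_diagram D e) (e ++ t) \/
   ~~ is_red (e ++ t) /\ reverses_direction (shift_diagram D e) (e ++ t)).
Proof.
have Ws := shift_vertex_end (or_introl (erefl (source e))).
have Wt := shift_vertex_end (or_intror (erefl (target e))).
have neq : (rcons e bp == e) = false by apply/eqP; exact: rcons_neq.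
have e1 c : e ++ [:: c] = rcons e c by rewrite cats1.
have e2 b c : e ++ [:: b; c] = rcons (rcons e b) c by rewrite -cat_rcons cats1.
move=> tl; have : [|| t == [:: bm], t == [:: up], t == [:: dn], t == [:: bp; bm],
    t == [:: bp; bp], t == [:: bp; up] | t == [:: bp; dn]].
  by move: t tl; apply/allP.
rewrite /preserves_direction /reverses_direction /= !shift_edge_leaf.
do 6?[case/orP]; move/eqP=> -> /=; rewrite !(e1, e2) !is_red_rcons !endsE /=;
  rewrite ?endsE /= -!/(shift_vertex e _).
all: split=> //; rewrite ?Ws ?Wt ?neq ?eqxx; by [left | right].
Qed.

(** The vertices of the domain avoid [New (rcons e bm) k], as [rcons e bm] is
    left unexpanded there; apart from these, [shift_vertex] is injective. *)
Lemma shift_expansion_iso : expansion_iso (shift_diagram D e).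
Proof.
have child_mem c : c \in [:: bm; bp] -> rcons e c \in replace_edge D e.
  move=> cc; apply/replace_edgeP; right; exists c => //.
  by rewrite child_blue; move: cc; rewrite !inE => /orP[] ->; rewrite ?orbT.
have X := expansion_replace D_expansion eD.
split.
- exact: expansion_replace (child_mem bp _).
- exact: expansion_replace (child_mem bm _).
have domP g := @double_replaceP bp g isT.
have codP g := @double_replaceP bm g isT.
have leafs : all (fun t => shift_leaf t \in leaves bm) (leaves bp) by [].
have leafi : all (fun t =>
    all (fun u => (shift_leaf t == shift_leaf u) ==> (t == u)) (leaves bp))
    (leaves bp) by [].
have leafo : all (fun u => has (fun t => shift_leaf t == u) (leaves bp))
    (leaves bm) by [].
apply: isomorphismI.
- split.
  + move=> g /domP[[gD ge]|[t tl ->]]; apply/codP => /=.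
      by rewrite shift_edge_kept //; left.
    rewrite shift_edge_leaf; right; exists (shift_leaf t) => //.
    exact: (allP leafs).
  + move=> g h /set_mem/domP gP /set_mem/domP hP /=.
    case: gP hP => [[gD ge]|[t tl ->]] [[hD he]|[u ul ->]];
      rewrite ?shift_edge_leaf ?shift_edge_kept //.
    * by move=> /(kept_neq gD ge).
    * by move/esym => /(kept_neq hD he).
    * move/eqP; rewrite eqseq_cat // eqxx /= => tu; congr cat; apply/eqP.
      exact: (implyP (allP (allP leafi _ tl) _ ul)).
  + move=> g /codP[[gD ge]|[u ul ->]].
      by exists g; [apply/domP; left | exact: shift_edge_kept].
    have /hasP[t tl /eqP <-] := allP leafo _ ul.
    by exists (e ++ t); [apply/domP; right; exists t | exact: shift_edge_leaf].
- have avoid v : vertices (dom (shift_diagram D e)) v ->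
      forall k, v <> New (rcons e bm) k.
    move=> [g gdom vg] k vk; rewrite vk in vg; have [c [s gE]] := new_prefix vg.
    rewrite cat_rcons in gE; case/domP: gdom => [[gD ge]|[t tl]].
      exact: kept_neq gD ge gE.
    rewrite gE => /eqP; rewrite eqseq_cat // eqxx /= => /eqP tE.
    rewrite -tE in tl.
    by case: c tl {gE tE} => //; case: s.
  move=> v w /set_mem/avoid vN /set_mem/avoid wN /=.
  case: v vN => [||||v k] vN; case: w wN => [||||w j] wN //=;
    try by case: eqP => // _; case: eqP.
  case: (v =P e) => [->|ve]; case: (w =P e) => [->|we].
  + by case; case: k {vN}; case: j {wN}.
  + case: eqP => _ [wE _]; last by case: (wN j); rewrite -wE.
    by case: (rcons_neq wE).
  + case: eqP => _ [vE _]; last by case: (vN k); rewrite vE.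
    by case: (rcons_neq (esym vE)).
  + case: eqP => [->|vp]; case: eqP => [->|wp] [] //.
    * by move=> ->.
    * by move=> /esym wE; case: (we wE).
    * by move=> -> ->.
move=> g /domP[[gD ge]|[t tl ->]] /=; last first.
  by rewrite shift_edge_leaf; exact: shift_leaf_direction.
rewrite shift_edge_kept //; split=> //; left.
rewrite /preserves_direction /= shift_edge_kept //.
by rewrite !(shift_vertex_kept gD ge) //; [right | left].
Qed.

End Shift.
Lemma ray_rcons rho k g c : radial rho -> ray rho k = rcons g c ->
  c \in [:: eL; eR; sr] \/ c = bp /\ exists j, g = ray rho j.
Proof.
move=> rr; case: k => [|k]; last first.
  by rewrite rayS => /rcons_inj[<- <-]; right; split; [|exists k].
by rewrite ray0 => rE; left; case/andP: rr => _; rewrite rE last_rcons.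
Qed.

(** The shift on the first half of an edge of a ray moves no edge reaching the
    tip of a ray, so all its extremal derivatives are trivial. *)
Lemma shift_in_E D w f : expansion D -> rcons w bm \in D ->
  graph_pair_diagram f (shift_diagram D (rcons w bm)) -> E f.
Proof.
set e := rcons w bm => XD eD fd.
have eb : ~~ is_red e by rewrite is_red_rcons.
apply: (canonical_in_E fd) => rho rr.
have [[_ [_ [_ _ _ [rho' rr' fr]]]]|[k [rho' [j [kD rr' kE fk]]]]] :=
  diagram_ray fd rr.
  by exists 0, rho'; rewrite !ray0.
exists k, rho'; split=> //.
case/(double_replaceP XD eD eb) : kD => // [[kD ke]|[t tl tE]]; last first.
  have wbm i : ray rho i <> e by move=> /(ray_rcons rr)[|[]].
  have e1 c : e ++ [:: c] = rcons e c by rewrite cats1.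
  have e2 b c : e ++ [:: b; c] = rcons (rcons e b) c by rewrite -cat_rcons cats1.
  move: tE; move: tl; rewrite /leaves !inE.
  do 6?[case/orP]; move/eqP=> ->; rewrite ?(e1, e2) => /(ray_rcons rr)[] //;
    case=> // _ [i].
  by move/esym/(ray_rcons rr)=> [|[_ [i']]] // /esym; case/wbm.
move: kE; rewrite /= (shift_edge_kept XD eD) // => kE.
have [_ jk] := ray_inj rr rr' kE.
by rewrite -jk in fk.
Qed.

(** The red edge [up] of the first circle moves to the circle inside the first
    half; in particular its radial edge moves, which witnesses that the shift
    is not trivial. *)
Lemma shift_moves D w f : expansion D -> rcons w bm \in D ->
  graph_pair_diagram f (shift_diagram D (rcons w bm)) ->
  canonical_on f (rcons w bm ++ [:: up]) (rcons w bm ++ [:: bm; dn]).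
Proof.
set e := rcons w bm => XD eD fd.
have upD : e ++ [:: up] \in dom (shift_diagram D e).
  apply/(double_replaceP XD eD) => //; first by rewrite is_red_rcons.
  by right; exists [:: up].
have [_ _ [_ _ /(_ _ upD)[_ dir]] /(_ _ upD)[fup _]] := fd.
have {dir} /fup : preserves_direction (shift_diagram D e) (e ++ [:: up]).
  by case: dir => // -[]; rewrite cats1 is_red_rcons.
by rewrite /= shift_edge_leaf.
Qed.

(** * The ascending union of subgroups *)

(** Beyond depth [n], every ray is mapped to a ray without a shift. *)
Definition keeps_rays (n : nat) (f : homeo airplane) : Prop :=
  forall rho, radial rho ->
    exists2 rho', radial rho' & canonical_on f (ray rho n) (ray rho' n).

Definition ray_subgroup (n : nat) : set (homeo airplane) :=
  [set f | keeps_rays n f /\ keeps_rays n f^-1%g].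

Lemma keeps_raysW m n f : m <= n -> keeps_rays m f -> keeps_rays n f.
Proof.
move=> le fm rho /fm[rho' rr' frho]; exists rho' => //.
by rewrite -(subnKC le) -!rayD; exact: canonical_cat.
Qed.

Lemma keeps_rays_comp n f g :
  keeps_rays n f -> keeps_rays n g -> keeps_rays n (f * g)%g.
Proof.
move=> fn gn rho rr; have [rho' rr' grho] := gn _ rr.
have [rho'' rr'' frho] := fn _ rr'; exists rho'' => //.
apply: canonical_comp grho frho; rewrite ?ray_edge //.
by rewrite !ray_blue.
Qed.

Lemma ray_subgroupW m n : m <= n -> ray_subgroup m `<=` ray_subgroup n.
Proof. by move=> le f [fm fm']; split; exact: keeps_raysW le _. Qed.

(** Depths are preserved exactly, so composing costs nothing; with a shift the
    depth [n] would have to grow. *)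
Lemma ray_subgroup_closed n : group_closed [in ray_subgroup n].
Proof.
split=> [|f g]; rewrite !inE.
  split; rewrite ?invg1 => rho rr; exists rho => // x y ex ey xy;
    by rewrite (same_tail_fun (And3 ex ex (fun=> erefl)) (And3 ex ey xy)).
move=> [fn fn'] [gn gn']; split; first exact: keeps_rays_comp.
by rewrite invgM invgK; exact: keeps_rays_comp.
Qed.

Lemma bounded_words (D : {fset word}) :
  exists N, forall e, e \in D -> size e <= N.
Proof.
exists (\max_(e <- D) size e) => e eD.
by rewrite (big_rem e) //= leq_maxl.
Qed.

(** The maps between truncated rays given by one diagram start at edges of its
    domain, hence at a bounded depth; a trivial derivative at the tip of each
    ray says that they involve no shift. The inverse is treated with the inverse
    diagram: the shifts it involves are opposite to those of [f]. *)
Lemma E_keeps_rays f : E f -> exists n, ray_subgroup n f.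
Proof.
move=> [_ fD].
have fray rho : radial rho ->
    exists k rho', radial rho' /\ canonical_on f (ray rho k) (ray rho' k).
  move=> rr; have [x xr] := extreme_exists rr.
  apply: (derivative_canonical rr xr); apply/fD/external_extreme_name.
  by exists rho, x.
have lr : radial [:: eL] by [].
have [x xl] := extreme_exists lr.
have [|d [fd _] _] := fD (point_of x).
  by apply/external_extreme_name; exists [:: eL], x.
have [d' fd'] := inverse_graph_pair fd.
have [N Nd] := bounded_words (dom d); have [N' Nd'] := bounded_words (dom d').
have fN : keeps_rays N f.
  move=> rho rr; have [k1 [rho1 [rr1 f1]]] := fray _ rr.
  have [[_ [_ [_ _ _ [rho2 rr2 f2]]]]|[k [rho2 [j [kD rr2 _ f2]]]]] :=
  diagram_ray fd rr.
    by exists rho2 => //; exact: canonical_cat.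
  have [_ jk] := canonical_ray_inj rr rr1 rr2 f1 f2.
  have E : j = k by move: jk; rewrite [k + _]addnC => /addnI.
  rewrite E in f2; exists rho2 => //.
  have le : k <= N by apply: leq_trans (Nd _ kD); rewrite size_ray leq_addl.
  by rewrite -(subnKC le) -!rayD; exact: canonical_cat.
exists (maxn N N'); split; first exact: keeps_raysW (leq_maxl _ _) fN.
apply: keeps_raysW (leq_maxr _ _) _ => rho rr.
have [[_ [_ [_ _ _ [rho2 rr2 f2]]]]|[k [rho2 [j [kD rr2 _ f2]]]]] :=
  diagram_ray fd' rr.
  by exists rho2 => //; exact: canonical_cat.
have [rho1 rr1 f1] := fN _ rr2.
have := canonical_inverse f2; rewrite invgK => f3.
have [_ jk] := canonical_ray_inj rr2 rr1 rr f1 f3.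
have E : j = k by move: jk; rewrite addnC => /addnI.
rewrite E in f2; exists rho2 => //.
have le : k <= N' by apply: leq_trans (Nd' _ kD); rewrite size_ray leq_addl.
by rewrite -(subnKC le) -!rayD; exact: canonical_cat.
Qed.

Theorem proposition8p1 : ~ finitely_generated E.
Proof.
case=> S [/finite_seqP[s ->] sE EgS].
have [n sn] : exists n, [set` s] `<=` ray_subgroup n.
  elim: s sE {EgS} => [|f s IH] sE; first by exists 0.
  have [|n sn] := IH; first by move=> g gs; apply: sE; rewrite /= inE gs orbT.
  have [|m fm] := @E_keeps_rays f; first by apply: sE; rewrite /= mem_head.
  exists (maxn m n) => g; rewrite /= inE => /orP[/eqP->|gs].
    exact: ray_subgroupW (leq_maxl _ _) _ fm.
  exact: ray_subgroupW (leq_maxr _ _) _ (sn _ gs).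
have En : E `<=` ray_subgroup n.
  apply: subset_trans EgS _; apply: smallest_sub sn.
  exact: ray_subgroup_closed.
have lr : radial [:: eL] by [].
(* A blue edge that lies beyond depth [n] on the ray of [eL] but does not reach
   its tip. *)
pose w := ray [:: eL] n; have ew : edge w by exact: ray_edge.
have wb : is_red w = false by exact: ray_blue.
have [D XD eD] : exists2 D, expansion D & rcons w bm \in D.
  apply: edge_expansion; rewrite edge_rcons; last exact: edge_neq0.
  by rewrite ew /child /replacement -/(is_red w) wb.
have di := shift_expansion_iso XD eD (negbT (is_red_rcons w bm)).
have [f fd] := diagram_realization di.
have [fn _] := En f (shift_in_E XD eD fd).
have [rho rr frho] := fn _ lr.
(* Two incompatible descriptions of the image of one radial edge. *)
have fu := canonical_cat (t := [:: sr]) (shift_moves XD eD fd).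
have frho' := canonical_cat (t := [:: bm; up; sr]) frho.
have radial_cat u t : edge u -> is_red u = false -> path child bm t ->
    last bm t = sr -> radial (u ++ bm :: t).
  move=> eu ub pt lt; rewrite /radial last_cat /=.
  rewrite edge_cat; last exact: edge_neq0.
  rewrite eu /= {1}/child /replacement -/(is_red u) ub pt /=.
  by rewrite lt.
rewrite -!cats1 -!catA in fu.
have r0 : radial (w ++ [:: bm; up; sr]) by apply: radial_cat.
have r1 : radial (w ++ [:: bm; bm; dn; sr]) by apply: radial_cat.
have r2 : radial (ray rho n ++ [:: bm; up; sr]).
  by apply: radial_cat; rewrite ?ray_edge ?ray_blue.
have : w ++ [:: bm; bm; dn; sr] = ray rho n ++ [:: bm; up; sr].
  exact: canonical_radial_inj r0 r1 r2 fu frho'.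
clearbody w; rewrite -!cat_rcons !cats0.
by move=> /rcons_inj[] /rcons_inj[].
Qed.
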